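(* Let $\mu=\bigotimes_{k=1}^n\mu_k$ be an unconditional product measure with decreasing density on $\mathbb{R}^n$. Let $\sigma\subset[n]$, let $m\ge\lambda\ge1$ be integers and let $(\sigma_1,\ldots,\sigma_m)$ be a $\lambda$-uniform cover of $\sigma$. Then for any 1-unconditional convex body $K\subset\mathbb{R}^n$, $$\mu(K)^{m-\lambda}\,\mu_{\sigma^c}(P_{E_\sigma}K)^{\lambda}\le\frac{\prod_{i=1}^m\binom{n-|\sigma_i|}{n-|\sigma|}}{\binom{n}{n-|\sigma|}^{m-\lambda}}\prod_{i=1}^m\mu_{\sigma_i^c}(P_{E_{\sigma_i}}K),$$ where $\tau^c=[n]\setminus\tau$ for $\tau\subset[n]$.
   Context: $[n]=\{1,\dots,n\}$ and $e_1,\dots,e_n$ is the standard basis of $\mathbb{R}^n$. A convex body is a nonempty compact convex set; $K$ is 1-unconditional if $\{(\delta_1x_1,\dots,\delta_nx_n):x\in K\}=K$ for all $\delta\in\{-1,1\}^n$. For $\tau\subset[n]$, $E_\tau:=\operatorname{span}\{e_i:i\in\tau\}^\perp$, $|\tau|$ is the cardinality of $\tau$, and $P_E$ is the orthogonal projection onto $E$. Sets $\sigma_1,\dots,\sigma_m\subset\sigma$ form a $\lambda$-uniform cover of $\sigma$ if every $j\in\sigma$ belongs to exactly $\lambda$ of the $\sigma_i$. An unconditional product measure with decreasing density is $\mu=\bigotimes_{k=1}^n\mu_k$, where each $\mu_k$ is a Borel measure on $\mathbb{R}$ with locally integrable density $\phi_k\ge0$ that is even and non-increasing on $[0,\infty)$;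 thus the density $\phi(x)=\prod_k\phi_k(x_k)$ of $\mu$ is invariant under sign changes of coordinates and non-increasing on $[0,\infty)$ in each coordinate. For $\tau\subset[n]$, $\mu_\tau=\bigotimes_{k\in\tau}\mu_k$ is regarded as a measure on $\operatorname{span}\{e_k:k\in\tau\}$, and $\mu_\emptyset(\{0\})=1$. *)

(* Defs.v *)
From mathcomp Require Import all_boot all_order all_algebra.
From mathcomp Require Import all_classical all_reals all_analysis.
From mathcomp Require Import measurable_realfun.

Set Implicit Arguments.
Unset Strict Implicit.
Unset Printing Implicit Defensive.
Import Order.TTheory GRing.Theory Num.Theory.
Import numFieldNormedType.Exports.

Local Open Scope classical_set_scope.
Local Open Scope ring_scope.

Definition dotv (R : realType) (n : nat) (x y : 'rV[R]_n) : R :=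
  \sum_(i < n) x 0 i * y 0 i.

(* A matrix whose row space is span {e_i : i \in tau}. *)
Definition span_basis (R : realType) (n : nat) (tau : {set 'I_n}) : 'M[R]_n :=
  (\sum_(i in tau) <<delta_mx 0 i : 'rV[R]_n>>)%MS.
Arguments span_basis {R n} tau.

Definition ortho_span (R : realType) (n : nat) (tau : {set 'I_n}) :
    set 'rV[R]_n :=
  [set x | forall y : 'rV[R]_n, (y <= span_basis tau)%MS -> dotv x y = 0].
Arguments ortho_span {R n} tau.

Definition is_ortho_proj (R : realType) (n : nat) (E : set 'rV[R]_n)
    (x y : 'rV[R]_n) : Prop :=
  E y /\ forall z, E z -> dotv (x - y) z = 0.

Definition ortho_proj (R : realType) (n : nat) (E K : set 'rV[R]_n) :
    set 'rV[R]_n :=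
  [set y | exists2 x, K x & is_ortho_proj E x y].

Definition convex_body (R : realType) (n : nat) (K : set 'rV[R]_n) : Prop :=
  [/\ K !=set0, compact K & convex_set K].

Definition unconditional (R : realType) (n : nat) (K : set 'rV[R]_n) : Prop :=
  forall delta : 'I_n -> R, (forall i, delta i = 1 \/ delta i = -1) ->
    [set \row_(i < n) (delta i * x 0 i) | x in K] = K.

Definition uniform_cover (n m lambda : nat) (sigma : {set 'I_n})
    (s : 'I_m -> {set 'I_n}) : Prop :=
  (forall i, s i \subset sigma) /\
  (forall j, j \in sigma -> #|[set i | j \in s i]| = lambda).

Definition even_decreasing_density (R : realType) (phi : R -> R) : Prop :=
  [/\ locally_integrable [set: R] phi,
      forall x, 0 <= phi x,
      forall x, phi (- x) = phi x &
      forall x y, 0 <= x -> x <= y -> phi y <= phi x].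

Definition has_density (R : realType)
    (mu : set (measurableTypeR R) -> \bar R) (phi : R -> R) : Prop :=
  forall A : set (measurableTypeR R), measurable A ->
    mu A = (\int[lebesgue_measure]_(x in A) (phi x)%:E)%E.

Definition cons_pair (T : Type) (n : nat) (p : T * n.-tuple T) :
    n.+1.-tuple T := [tuple of p.1 :: p.2].

(* The product of mu_0, ..., mu_(n-1) on n-tuples, iterating the binary product
   measure; it is a measure as soon as the mu_i are sigma-finite, which a
   locally integrable density guarantees. *)
Fixpoint prod_measure (R : realType) (n : nat) :
    ('I_n -> set (measurableTypeR R) -> \bar R) ->
    set (n.-tuple (measurableTypeR R)) -> \bar R :=
  match n with
  | 0 => fun _ => \d_([tuple] : 0.-tuple (measurableTypeR R))
  | n'.+1 => fun mu =>
      pushforward (mu ord0 \x prod_measure (fun i => mu (lift ord0 i)))%E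
        (@cons_pair (measurableTypeR R) n')
  end.

Lemma prod_measure0 (R : realType) (n : nat)
    (mu : 'I_n -> {measure set (measurableTypeR R) -> \bar R}) :
  prod_measure mu set0 = 0%E.
Proof.
elim: n mu => [|n IH] mu /=; first by rewrite /dirac indic0.
rewrite /pushforward preimage_set0 /product_measure1 integral0_eq// => x _ /=.
by rewrite xsection0 (IH (fun i => mu (lift ord0 i))).
Qed.

Lemma prod_measure_box (R : realType) (n : nat)
    (mu : 'I_n -> {measure set (measurableTypeR R) -> \bar R})
    (A : 'I_n -> set (measurableTypeR R)) : (forall i, measurable (A i)) ->
  prod_measure mu [set t | forall i, A i (tnth t i)] =
    (\prod_(i < n) mu i (A i))%E.
Proof.
elim: n mu A => [|n IH] mu A mA /=.
  rewrite big_ord0 /dirac indicE mem_set//= => -[].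
  by case.
rewrite big_ord_recl /pushforward /product_measure1.
under eq_integral do rewrite /=.
set c := \big[_/_]_(i < n) _.
have c0 : (0 <= c)%E by apply: prode_ge0 => i _; exact: measure_ge0.
rewrite (eq_integral (fun x => (\1_(A ord0) x)%:E * c)%E); last first.
  move=> x _; rewrite indicE /=.
  case: (boolP (x \in A ord0)) => [/set_mem xA|/negP xA] /=.
    rewrite mul1e /c -(IH (fun i => mu (lift ord0 i)) (fun i => A (lift ord0 i)))//.
    congr (prod_measure _ _); apply/seteqP; split => t.
      rewrite /xsection/= inE/= => h i; have := h (lift ord0 i).
      by rewrite /cons_pair/= tnthS.
    rewrite /xsection/= inE/= => h i; case: (unliftP ord0 i) => [j ->|->].
      by rewrite /cons_pair tnthS.
    by [].
  rewrite mul0e.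
  rewrite [X in prod_measure _ X](_ : _ = set0).
    exact: (prod_measure0 (fun i => mu (lift ord0 i))).
  apply/seteqP; split => t //; rewrite /xsection/= inE/= => /(_ ord0) h.
  by apply: xA; rewrite inE.
rewrite ge0_integralZr//.
- by rewrite integral_indic// setIT.
- by apply/measurable_EFinP; exact: measurable_indic.
Qed.

Definition coord_embed (R : realType) (n : nat) (tau : {set 'I_n})
    (t : #|tau|.-tuple (measurableTypeR R)) : 'rV[R]_n :=
  \sum_(i < #|tau|) (tnth t i : R) *: delta_mx 0 (enum_val i).

(* mu_tau, as a measure on R^n carried by span {e_k : k \in tau}: the product
   measure on R^tau transported by the coordinate isomorphism onto the span. *)
Definition sub_measure (R : realType) (n : nat)
    (mu : 'I_n -> set (measurableTypeR R) -> \bar R) (tau : {set 'I_n})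
    (A : set 'rV[R]_n) : \bar R :=
  prod_measure (fun i : 'I_#|tau| => mu (enum_val i))
    (@coord_embed R n tau @^-1` A).

(* Main.v *)
From HB Require Import structures.
Require Import Defs.
From mathcomp Require Import all_boot all_order all_algebra.
From mathcomp Require Import all_classical all_reals all_analysis.
From mathcomp Require Import measurable_realfun ring lra.
Set Implicit Arguments.
Unset Strict Implicit.
Unset Printing Implicit Defensive.
Import Order.TTheory GRing.Theory Num.Theory.
Import numFieldNormedType.Exports.
Local Open Scope classical_set_scope.
Local Open Scope ring_scope.

(** An unconditional convex body is solid: shrinking the coordinates of a point
    keeps it in the body. Hence [P_E K] is the section of [K] by [E], and, with
    [k = m - lambda], [d = #|sigma|], [l = n - d], every measure in the statement
    is the integral over [L = P_(E_sigma) K] of the volumes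
    [f_i(x) = mu_(sigma \ sigma_i)(K_x)] of coordinate sections of the fibers
    [K_x]; these satisfy [mu_sigma(K_x)^k <= prod_i f_i(x)] by Loomis-Whitney for
    uniform covers.
    An even measure with decreasing density is concave on symmetric intervals,
    so the one-dimensional Borell-Brascamp-Lieb argument by level sets gives, by
    induction on the dimension, a Brunn-Minkowski inequality for product measures
    of solid sets. It makes [g_i = f_i^(1/a_i)], [a_i = #|sigma \ sigma_i|],
    concave on [L], and the [l]-th root of [t |-> mu_(sigma^c){g_i >= t}] concave
    in [t]. Comparing this tail with that of a cone, [(1 - t/T)^l] (Berwald), bounds
    the integral of [g_i^d] by that of [g_i^(a_i)], with the binomials coming from
    Beta integrals. Since [sum_i a_i = k d], Hoelder's inequality for the [k d]
    functions [g_i^d] (each repeated [a_i] times) concludes. *)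

(** * Finite measures on tuples *)

(** Two obstacles shape the development. The [mu k] may be infinite, while the tail arguments want
    real numbers: as [K] is bounded, each [mu k] is replaced by its restriction to some [[-M, M]],
    which is finite and still concave on symmetric intervals. And many dimensions occur at once: all
    measures therefore act on [n]-tuples, with a Dirac mass at 0 in each coordinate outside the
    index set, so that one set serves for every projection and section without reindexing.
    Inequalities are stated for powers, or with an explicit upper bound, rather than with roots;
    this keeps them meaningful when [a_i = 0] or [l = 0].

    The constants come from cones. With [V = mu_(sigma^c)(L)], let [t_i] be the height at which the
    tail [V (1 - t/t_i)^l] has the same [a_i]-th moment as [g_i]. That moment is
    [V t_i^(a_i) / C(l + a_i, l)], and [l + a_i = n - #|sigma_i|]. Berwald bounds the [d]-th moment
    of [g_i] by [V t_i^d / C(n, l)]. A factor [V^m] in front of [mu(K)^k] turns the product of the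
    [t_i^(a_i)] into that of the right-hand side, and cancelling [V^k] leaves [V^lambda]. *)

Definition box (R : realType) (n : nat) (A : 'I_n -> set (measurableTypeR R)) :
  set (n.-tuple (measurableTypeR R)) := [set t | forall i, A i (tnth t i)].

Lemma measurable_box (R : realType) n (A : 'I_n -> set (measurableTypeR R)) :
  (forall i, measurable (A i)) -> measurable (box A).
Proof.
move=> mA; rewrite (_ : box A = \bigcap_(i in [set: 'I_n]) ((fun t => tnth t i) @^-1` A i)).
  apply: fin_bigcap_measurable => // i _.
  rewrite -[X in measurable X]setTI; apply: measurable_tnth => //.
by apply/seteqP; split=> t /= h i => [_|]; [exact: h|exact: (h i)].
Qed.

(** Boxes form a pi-system that contains the whole space and generates the product sigma-algebra: a
    cylinder is a box whose other sides are full. *)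
Lemma box_measure_unique (R : realType) n
    (m1 m2 : {finite_measure set (n.-tuple (measurableTypeR R)) -> \bar R}) :
  (forall A : 'I_n -> set (measurableTypeR R), (forall i, measurable (A i)) ->
     m1 (box A) = m2 (box A)) ->
  forall X, measurable X -> m1 X = m2 X.
Proof.
move=> h X mX.
pose G : set (set (n.-tuple (measurableTypeR R))) :=
  [set B | exists2 A : 'I_n -> set (measurableTypeR R), (forall i, measurable (A i)) & B = box A].
have GT : G setT.
  by exists (fun=> setT) => //; apply/seteqP; split=> t /=.
apply: (measure_unique G (fun=> setT)) => //.
- apply/seteqP; split; last first.
    apply: smallest_sub; first exact: sigma_algebra_measurable.
    by move=> _ [A mA ->]; exact: measurable_box.
  apply: smallest_sub; first exact: smallest_sigma_algebra.
  move=> B; rewrite -bigcup_seq => -[i /= _ [A mA <-]].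
  apply: sub_sigma_algebra; exists (fun j => if j == i then A else setT).
    by move=> j; case: ifP.
  rewrite setTI; apply/seteqP; split=> t /=.
    by move=> At j; case: eqP => // ->.
  by move=> /(_ i); rewrite eqxx.
- move=> _ _ [A mA ->] [B mB ->]; exists (fun i => A i `&` B i).
    by move=> i; exact: measurableI.
  apply/seteqP; split=> t /=; first by move=> [hA hB] i; split.
  by move=> hAB; split=> i; have [] := hAB i.
- by apply/seteqP; split=> // x _; exists 0.
- by move=> _ [A mA ->]; exact: h.
- by move=> _; rewrite -ge0_fin_numE// fin_num_measure.
Qed.

Section finite_constructions.
Context d1 d2 (T1 : measurableType d1) (T2 : measurableType d2) (R : realType).

Section pushforward.
Variables (mu : {finite_measure set T1 -> \bar R}) (f : T1 -> T2).
Hypothesis mf : measurable_fun [set: T1] f.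

(** The measurability proof is an argument so that the measure instances below can be attached to
    this set function. *)
Definition fpushforward (mf' : measurable_fun [set: T1] f) := pushforward mu f.
Let nu := fpushforward mf.

Let nu0 : nu set0 = 0%E.
Proof. by rewrite /nu /fpushforward /pushforward preimage_set0 measure0. Qed.
Let nu_ge0 A : (0 <= nu A)%E.
Proof. exact: measure_ge0. Qed.
Let nu_sigma_additive : semi_sigma_additive nu.
Proof.
move=> F mF tF mUF.
have mpre A : measurable A -> measurable (f @^-1` A).
  by move=> mA; rewrite -[X in measurable X]setTI; exact: mf.
rewrite /nu /fpushforward /pushforward preimage_bigcup.
apply: measure_semi_sigma_additive.
- by move=> i; exact: mpre.
- apply/trivIsetP => i j _ _ ij; rewrite -preimage_setI.
  by move/trivIsetP : tF => /(_ i j I I ij) ->; rewrite preimage_set0.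
- by rewrite -preimage_bigcup; exact: mpre.
Qed.
HB.instance Definition _ :=
  isMeasure.Build _ _ _ (fpushforward mf) nu0 nu_ge0 nu_sigma_additive.
Let nu_fin : fin_num_fun (fpushforward mf).
Proof.
move=> A mA; rewrite /fpushforward /pushforward fin_num_measure//.
by rewrite -[X in measurable X]setTI; exact: mf.
Qed.
HB.instance Definition _ := Measure_isFinite.Build _ _ _ (fpushforward mf) nu_fin.
End pushforward.

Definition fprod (m1 : {finite_measure set T1 -> \bar R})
  (m2 : {finite_measure set T2 -> \bar R}) := (m1 \x m2)%E.
Section prod.
Variables (m1 : {finite_measure set T1 -> \bar R})
  (m2 : {finite_measure set T2 -> \bar R}).
HB.instance Definition _ := Measure.on (fprod m1 m2).
Let prod_fin : fin_num_fun (fprod m1 m2).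
Proof.
move=> A mA; rewrite ge0_fin_numE//.
apply: (@le_lt_trans _ _ (fprod m1 m2 setT)).
  by apply: le_measure => //; rewrite inE.
rewrite -setXTT /fprod product_measure1E//.
by rewrite -ge0_fin_numE ?mule_ge0// fin_numM// fin_num_measure.
Qed.
HB.instance Definition _ := Measure_isFinite.Build _ _ _ (fprod m1 m2) prod_fin.
End prod.
End finite_constructions.

Section product.
Context (R : realType).
Local Notation Rm := (measurableTypeR R).

Lemma measurable_cons_pair n :
  measurable_fun [set: Rm * n.-tuple Rm] (@cons_pair Rm n).
Proof. exact: (measurable_cons measurable_fst measurable_snd). Qed.

(** The recursion of [prod_measure], run inside bundled finite measures so that additivity and
    Tonelli are available at every stage. *)
Fixpoint tuple_measure n : ('I_n -> {finite_measure set Rm -> \bar R}) ->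
    {finite_measure set (n.-tuple Rm) -> \bar R} :=
  match n with
  | 0 => fun _ => \d_([tuple] : 0.-tuple Rm)
  | n'.+1 => fun mu => fpushforward
      (fprod (mu ord0) (tuple_measure (fun i => mu (lift ord0 i))))
      (@measurable_cons_pair n')
  end.

Lemma tuple_measureE n (mu : 'I_n -> {finite_measure set Rm -> \bar R}) :
  tuple_measure mu = prod_measure mu :> (set _ -> \bar R).
Proof.
elim: n mu => [//|n IH] mu /=; rewrite -IH.
by [].
Qed.
End product.

Section coordinate_measures.
Context (R : realType) (n : nat).
Local Notation Rm := (measurableTypeR R).
Local Notation T := (n.-tuple (measurableTypeR R)).

Definition row_of (t : T) : 'rV[R]_n := \row_i tnth t i.

Definition embed (S : {set 'I_n}) (t : #|S|.-tuple Rm) : T :=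
  [tuple (coord_embed t : 'rV[R]_n) 0 k | k < n].

Lemma coord_embedE (S : {set 'I_n}) (t : #|S|.-tuple Rm) (k : 'I_n) :
  (coord_embed t : 'rV[R]_n) 0 k =
  \sum_(i < #|S|) (tnth t i : R) * (enum_val i == k)%:R.
Proof.
rewrite summxE; apply: eq_bigr => i _.
by rewrite !mxE eqxx /= eq_sym.
Qed.

Lemma coord_embed_val (S : {set 'I_n}) (t : #|S|.-tuple Rm) (i : 'I_#|S|) :
  (coord_embed t : 'rV[R]_n) 0 (enum_val i) = tnth t i.
Proof.
rewrite coord_embedE (bigD1 i)//= eqxx mulr1 big1 ?addr0// => j ji.
by rewrite (inj_eq enum_val_inj) (negbTE ji) mulr0.
Qed.

Lemma coord_embed_out (S : {set 'I_n}) (t : #|S|.-tuple Rm) (k : 'I_n) :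
  k \notin S -> (coord_embed t : 'rV[R]_n) 0 k = 0.
Proof.
move=> kS; rewrite coord_embedE big1// => i _.
by case: eqP => [ik|]; rewrite ?mulr0//; move: kS; rewrite -ik enum_valP.
Qed.

Lemma row_of_embed (S : {set 'I_n}) (t : #|S|.-tuple Rm) :
  row_of (embed t) = coord_embed t.
Proof. by apply/rowP => k; rewrite mxE tnth_mktuple. Qed.

Lemma measurable_embed (S : {set 'I_n}) :
  measurable_fun [set: #|S|.-tuple Rm] (@embed S).
Proof.
apply/measurable_fun_tnthP => k.
have [kS|kS] := boolP (k \in S); last first.
  rewrite (_ : _ \o _ = cst 0)//; apply/funext => t /=.
  by rewrite tnth_mktuple coord_embed_out.
rewrite (_ : _ \o _ = (fun t => tnth t (enum_rank_in kS k))).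
  exact: measurable_tnth.
apply/funext => t /=; rewrite tnth_mktuple.
by rewrite -[in LHS](enum_rankK_in kS kS) coord_embed_val.
Qed.

Variable mu : 'I_n -> {finite_measure set Rm -> \bar R}.

(* [sub_measure mu S], carried by n-tuples that vanish outside [S]. *)
Definition coord_measure (S : {set 'I_n}) : {finite_measure set T -> \bar R} :=
  fpushforward (tuple_measure (fun i : 'I_#|S| => mu (enum_val i)))
    (@measurable_embed S).

Lemma coord_measureE (S : {set 'I_n}) (K : set 'rV[R]_n) :
  coord_measure S (row_of @^-1` K) = sub_measure mu S K.
Proof.
rewrite /coord_measure /= /fpushforward /pushforward tuple_measureE /sub_measure.
by congr prod_measure; apply/seteqP; split=> t /=; rewrite row_of_embed.
Qed.

(** Only tuples vanishing outside [S] are charged. This lets a set be traded for its central slice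
    or its projection. *)
Lemma coord_measure_supp (S : {set 'I_n}) (A B : set T) :
  (forall t : T, (forall k, k \notin S -> tnth t k = 0) -> A t <-> B t) ->
  coord_measure S A = coord_measure S B.
Proof.
move=> h; rewrite /coord_measure /= /fpushforward /pushforward; congr (tuple_measure _ _).
by apply/seteqP; split=> t /=; apply h => k kS; rewrite tnth_mktuple coord_embed_out.
Qed.

(** [coord_measure S] is the product of the [mu k] for [k] in [S] with Dirac masses at 0, which give
    the indicator factors. *)
Lemma coord_measure_box (S : {set 'I_n}) (A : 'I_n -> set Rm) :
  (forall i, measurable (A i)) ->
  coord_measure S (box A) = (\prod_k if k \in S then mu k (A k) else (\1_(A k) (0 : R))%:E)%E.
Proof.
move=> mA; rewrite /coord_measure /= /fpushforward /pushforward tuple_measureE.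
have [A0|/existsNP[k /not_implyP[kS Ak0]]] := pselect (forall k, k \notin S -> A k 0).
  transitivity (\prod_(i < #|S|) mu (enum_val i) (A (enum_val i)))%E.
    rewrite -prod_measure_box//; congr prod_measure.
    apply/seteqP; split=> t /= ht i.
      by have := ht (enum_val i); rewrite tnth_mktuple coord_embed_val.
    rewrite tnth_mktuple; have [iS|iS] := boolP (i \in S).
      have := ht (enum_rank_in iS i).
      by rewrite -[in X in _ -> X](enum_rankK_in iS iS) coord_embed_val.
    by rewrite coord_embed_out//; exact: A0.
  rewrite -(big_enum_val (fun k => mu k (A k))) /= [RHS](bigID (mem S))/=.
  rewrite [X in (_ * X)%E]big1 ?mule1.
    by apply: eq_bigr => k ->.
  by move=> k kS; rewrite (negbTE kS) indicE mem_set//; exact: A0.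
rewrite [RHS](bigD1 k)//= (negbTE kS) indicE memNset// mul0e.
rewrite (_ : _ @^-1` _ = set0) -?tuple_measureE ?measure0//.
apply/seteqP; split=> t //= /(_ k).
by rewrite tnth_mktuple coord_embed_out.
Qed.

Lemma coord_measure_set0 (A : set T) :
  coord_measure finset.set0 A = (\1_A ([tuple 0 | k < n] : T))%:E.
Proof.
have [A0|A0] := pselect (A [tuple 0 | k < n]).
  rewrite (@coord_measure_supp _ _ (box (fun=> setT))).
    rewrite coord_measure_box// big1 ?indicE ?mem_set//= => k _.
    by rewrite finset.in_set0 ?mem_set.
  move=> t t0; rewrite (_ : t = [tuple 0 | k < n])//.
  by apply: eq_from_tnth => k; rewrite t0 ?inE// tnth_mktuple.
rewrite (@coord_measure_supp _ _ set0) ?measure0 ?indicE ?memNset//.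
move=> t t0; rewrite (_ : t = [tuple 0 | k < n])//.
by apply: eq_from_tnth => k; rewrite t0 ?inE// tnth_mktuple.
Qed.

Definition merge (S : {set 'I_n}) (x y : T) : T :=
  [tuple if k \in S then tnth x k else tnth y k | k < n].

Lemma measurable_merge (S : {set 'I_n}) :
  measurable_fun [set: T * T] (fun p => merge S p.1 p.2).
Proof.
apply/measurable_fun_tnthP => k.
rewrite (_ : _ \o _ = (fun p => tnth (if k \in S then p.1 else p.2) k)).
  case: (k \in S).
    exact: (measurableT_comp (measurable_tnth k) measurable_fst).
  exact: (measurableT_comp (measurable_tnth k) measurable_snd).
by apply/funext => p /=; rewrite tnth_mktuple; case: ifP.
Qed.

(** Tonelli for disjoint index sets: the product of the two measures, pushed forward by [merge],
    agrees with the left-hand measure on boxes. *)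
Lemma coord_measure_merge (S S' : {set 'I_n}) (A : set T) : (forall k, k \in S -> k \notin S') ->
  measurable A ->
  coord_measure (S :|: S') A =
    (\int[coord_measure S]_x coord_measure S' [set y | A (merge S x y)])%E.
Proof.
move=> SS' mA.
transitivity (fpushforward (fprod (coord_measure S) (coord_measure S'))
    (measurable_merge S) A); last first.
  rewrite /fpushforward /pushforward/= /fprod/= /product_measure1.
  apply: eq_integral => x _ /=; congr (coord_measure S' _).
  by apply/seteqP; split=> y; rewrite /xsection /= inE.
apply: box_measure_unique => // {mA} {}A mA.
rewrite coord_measure_box//= /fpushforward /pushforward.
(* The preimage of a box under [merge] is a rectangle: [x] is constrained on [S] only and [y] off
   [S] only. *)
pose A1 k := if k \in S then A k else setT.
pose A2 k := if k \in S then setT else A k.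
rewrite (_ : _ @^-1` _ = box A1 `*` box A2); last first.
  apply/seteqP; split=> -[x y] /=.
    by move=> h; split=> k; have := h k; rewrite tnth_mktuple /A1 /A2; case: ifP.
  move=> [h1 h2] k; have := h1 k; have := h2 k.
  by rewrite tnth_mktuple /A1 /A2; case: ifP.
rewrite /fprod product_measure1E; last 2 first.
- by apply: measurable_box => k; rewrite /A1; case: ifP.
- by apply: measurable_box => k; rewrite /A2; case: ifP.
transitivity (coord_measure S (box A1) * coord_measure S' (box A2))%E; last by [].
rewrite !coord_measure_box; try by move=> k; rewrite /A1 /A2; case: (k \in S).
rewrite -big_split/=; apply: eq_bigr => k _; rewrite /A1 /A2 inE.
have [kS|kS] /= := boolP (k \in S).
  by rewrite (negbTE (SS' _ kS)) indicE mem_set ?mule1.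
by case: ifP => // _; rewrite indicT/= mul1e.
Qed.

Lemma coord_measure_marginal (j : 'I_n) (X : set Rm) : measurable X ->
  coord_measure [set j]%SET [set t | X (tnth t j)] = mu j X.
Proof.
move=> mX; pose A k := if k == j then X else setT.
rewrite (_ : [set t | _] = box A).
  rewrite coord_measure_box; last by move=> k; rewrite /A; case: ifP.
  rewrite (bigD1 j)//= inE eqxx big1 ?mule1 /A ?eqxx// => k kj.
  by rewrite finset.in_set1 (negbTE kj) indicE mem_set.
apply/seteqP; split=> t /=.
  by move=> Xt k; rewrite /A; case: eqP => // ->.
by move=> /(_ j); rewrite /A eqxx.
Qed.

End coordinate_measures.

(** * Measures with even decreasing density *)

(** On the line this means an interval centred at 0, with or without its endpoints, possibly empty
    or unbounded. *)
Definition solid1 (R : realType) (U : set R) : Prop :=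
  forall x y, U y -> `|x| <= `|y| -> U x.

(** [W] stands for any measurable set containing the Minkowski combination of [U] and [V], whose own
    measurability thus never has to be shown. Apart from finiteness on bounded intervals, the
    densities are used only through this property. *)
Definition concave_on_solid (R : realType)
    (m : set (measurableTypeR R) -> \bar R) : Prop :=
  forall (s : R) (U V W : set (measurableTypeR R)), 0 <= s -> s <= 1 ->
    measurable U -> measurable V -> measurable W ->
    solid1 U -> solid1 V -> U 0 -> V 0 ->
    (forall x y, U x -> V y -> W ((1 - s) * x + s * y)) ->
    ((1 - s)%:E * m U + s%:E * m V <= m W)%E.

Section density.
Context (R : realType) (mu : {measure set (measurableTypeR R) -> \bar R}).
Context (phi : R -> R) (hphi : even_decreasing_density phi) (hmu : has_density mu phi).

Let phi_ge0 x : 0 <= phi x. Proof. by case: hphi. Qed.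
Let phi_dec x y : `|x| <= `|y| -> phi y <= phi x.
Proof.
case: hphi => _ _ phiN dec xy.
have phi_norm z : phi `|z| = phi z by case: (ger0P z); rewrite ?phiN.
by rewrite -(phi_norm x) -(phi_norm y); exact: dec.
Qed.
Let mphi : measurable_fun [set: R] phi.
Proof. by case: hphi => -[]. Qed.

Lemma density_bounds (D : set (measurableTypeR R)) (a b : R) : measurable D ->
  (forall x, D x -> a <= phi x <= b) -> 0 <= a -> 
  (a%:E * lebesgue_measure D <= mu D <= b%:E * lebesgue_measure D)%E.
Proof.
move=> mD ab a0; rewrite hmu// -!integral_cst//.
apply/andP; split; apply: ge0_le_integral => //.
- apply/measurable_EFinP; exact: measurable_funS mphi.
- by move=> x /ab/andP[]; rewrite lee_fin.
- by move=> x Dx; rewrite lee_fin.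
- apply/measurable_EFinP; exact: measurable_funS mphi.
- by move=> x /ab/andP[]; rewrite lee_fin.
Qed.

Let I (r : R) : set (measurableTypeR R) := [set` `[- r, r]].
Let mI r : measurable (I r). Proof. exact: measurable_itv. Qed.
Let psi (r : R) : R := fine (mu (I r)).

Lemma density_itv_fin r : mu (I r) \is a fin_num.
Proof.
rewrite ge0_fin_numE//.
have phi0 x : I r x -> 0 <= phi x <= phi 0 by rewrite phi_ge0 phi_dec// normr0.
have /andP[_ h] := density_bounds (mI r) phi0 (lexx 0); apply: (le_lt_trans h).
rewrite lebesgue_measure_itv; case: ifP => _; rewrite ?mule0 ?ltry//.
Qed.

(** Formally [psi] has derivative [2 * phi r]. As [phi] need not be continuous, these bounds, read
    off the two intervals between radii [r] and [r'], replace the derivative. *)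
Lemma density_itv_increment r r' : 0 <= r -> r <= r' ->
  2 * phi r' * (r' - r) <= psi r' - psi r <= 2 * phi r * (r' - r).
Proof.
move=> r0 rr'.
pose D : set (measurableTypeR R) := `[- r', - r[%classic `|` `]r, r']%classic.
have mD : measurable D by exact: measurableU.
have Dphi x : D x -> phi r' <= phi x <= phi r.
  rewrite /D /= !in_itv/= => Dx.
  have [h1 h2] : `|x| <= `|r'| /\ `|r| <= `|x|.
    rewrite (ger0_norm r0) (ger0_norm (le_trans r0 rr')) ler_norml.
    case: Dx => /andP[x1 x2].
      by rewrite ltr0_norm ?(lt_le_trans x2) ?oppr_le0//; split; lra.
    by rewrite gtr0_norm ?(le_lt_trans r0)//; split; lra.
  by rewrite !phi_dec.
have lD : lebesgue_measure D = (2 * (r' - r))%:E.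
  rewrite measureU//; last first.
    apply/seteqP; split=> x //=; rewrite !in_itv/= => -[/andP[? ?] /andP[? ?]]; lra.
  rewrite /= !lebesgue_measure_itv/= !lte_fin ltrN2.
  have [->|neq] := eqVneq r r'; first by rewrite ltxx adde0 subrr mulr0.
  by rewrite lt_def eq_sym neq rr' -!EFinB -EFinD; congr EFin; ring.
have IU : I r' = I r `|` D.
  apply/seteqP; split=> x /=; rewrite /I /D /= !in_itv/=.
    move=> /andP[? ?]; have [?|?] := leP (- r) x; have [?|?] := leP x r; lra.
  by move=> [/andP[? ?]|[/andP[? ?]|/andP[? ?]]]; apply/andP; split; lra.
have muU : (mu (I r') = mu (I r) + mu D)%E.
  rewrite IU measureU//.
  apply/seteqP; split=> x //=; rewrite /I /D /= !in_itv/= =>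
    -[/andP[? ?] [/andP[? ?]|/andP[? ?]]]; lra.
have Dfin : mu D \is a fin_num.
  have := density_itv_fin r'; rewrite muU fin_numD => /andP[_].
  by [].
have := @density_bounds D _ _ mD Dphi (phi_ge0 _).
rewrite /psi muU fineD ?density_itv_fin// addrAC subrr add0r lD.
rewrite -[mu D]fineK// -!EFinM !lee_fin => /andP[h1 h2].
by apply/andP; split; lra.
Qed.

(** At the intermediate radius [w], the chord slope before [w] is at least [2 * phi w] and the one
    after it at most [2 * phi w]. *)
Lemma density_itv_concave s r r' : 0 <= s -> s <= 1 -> 0 <= r -> 0 <= r' ->
  (1 - s) * psi r + s * psi r' <= psi ((1 - s) * r + s * r').
Proof.
move=> s0 s1 r0 r'0; set rho := _ + _.
have main p q u v : 0 <= p -> 0 <= q -> p + q = 1 -> 0 <= u -> u <= v ->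
    p * psi u + q * psi v <= psi (p * u + q * v).
  move=> p0 q0 pq u0 uv; have pE : p = 1 - q by lra.
  have u1 : u <= p * u + q * v by rewrite pE; nra.
  have v1 : p * u + q * v <= v by rewrite pE; nra.
  have /andP[h1 _] := density_itv_increment u0 u1.
  have /andP[_ h2] := density_itv_increment (le_trans u0 u1) v1.
  have := ler_wpM2l p0 h1; have := ler_wpM2l q0 h2.
  set w := p * u + q * v => H1 H2.
  have e : p * (2 * phi w * (w - u)) = q * (2 * phi w * (v - w)).
    by rewrite /w pE; ring.
  rewrite pE in H2 e *; lra.
have [rr'|/ltW rr'] := leP r r'; first by apply: main => //; lra.
rewrite addrC /rho [_ + s * _]addrC; apply: main => //; lra.
Qed.

Lemma density_concave_on_solid (M : R) : 0 <= M ->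
  concave_on_solid (fun U => mu (U `&` I M)).
Proof.
move=> M0 s U V W s0 s1 mU mV mW sU sV U0 V0 UVW.
(* [X] within [[-M, M]] is an interval about 0 whose radius is its supremum. It may lack its
   endpoints, so it is compared with the closed interval from above and the open one from below; the
   point 0 is kept apart for radius 0. *)
have key (X : set (measurableTypeR R)) : measurable X -> solid1 X -> X 0 ->
    exists r, [/\ 0 <= r, (mu (X `&` I M) <= (psi r)%:E)%E,
      forall x, `|x| < r -> (X `&` I M) x & (X `&` I M) 0].
  move=> mX sX X0; exists (sup (X `&` I M)).
  have XM0 : (X `&` I M) 0 by split=> //; rewrite /I /= in_itv/=; lra.
  have hs : has_sup (X `&` I M).
    split; first by exists 0.
    by exists M => x [_]; rewrite /I /= in_itv/= => /andP[].
  have XN x y : (X `&` I M) y -> `|x| <= `|y| -> (X `&` I M) x.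
    move=> [Xy Iy] xy; split; first exact: sX xy.
    move: Iy; rewrite /I /= !in_itv/= -!ler_norml; exact: le_trans.
  have XMs x : (X `&` I M) x -> x <= sup (X `&` I M).
    by move=> ?; apply: sup_upper_bound.
  split=> //.
  - by apply: XMs.
  - rewrite /psi fineK ?density_itv_fin//; apply: le_measure; rewrite ?inE//.
      exact: measurableI.
    move=> x Xx; rewrite /I /= in_itv/= -ler_norml; apply: XMs.
    by apply: XN Xx _; rewrite normr_id.
  - move=> x; rewrite -subr_gt0 => xs; have [y Xy xy] := sup_adherent xs hs.
    apply: (XN _ y) => //; rewrite (le_trans _ (ler_norm y))// ltW//.
    by move: xy; rewrite opprB addrC subrK.
have [r [r0 mr Ur UM0]] := key U mU sU U0.
have [r' [r'0 mr' Vr VM0]] := key V mV sV V0.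
have := density_itv_concave s0 s1 r0 r'0; set rho := _ + s * r' => hpsi.
have rho0 : 0 <= rho by rewrite /rho addr_ge0// mulr_ge0// subr_ge0.
apply: (@le_trans _ _ ((1 - s) * psi r + s * psi r')%:E).
  rewrite [leRHS]EFinD !EFinM; apply: leeD; apply: lee_wpmul2l => //; rewrite lee_fin; lra.
apply: (@le_trans _ _ (psi rho)%:E); first by rewrite lee_fin.
(* A measure with a density does not charge endpoints, so it is enough to cover the open interval of
   radius [rho]. *)
rewrite /psi fineK ?density_itv_fin// hmu//  /I integral_itv_bndoo; last first.
  by apply/measurable_EFinP; exact: measurable_funS mphi.
rewrite -hmu//; apply: le_measure; rewrite ?inE//.
  exact: measurableI.
move=> w; rewrite /= in_itv/= -ltr_norml => wrho.
have rhop : 0 < rho := le_lt_trans (normr_ge0 _) wrho.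
(* Scaling both radii by the same ratio [th], of modulus less than 1, splits [w] into points
   [th * r] and [th * r'] of the two sets. *)
pose th := w / rho.
have th1 : `|th| < 1 by rewrite normf_div (gtr0_norm rhop) ltr_pdivrMr ?mul1r.
have thU (X : set (measurableTypeR R)) c : 0 <= c ->
   (forall x, `|x| < c -> (X `&` I M) x) -> (X `&` I M) 0 -> (X `&` I M) (th * c).
  move=> c0 hX X0; have [->|cn] := eqVneq c 0; first by rewrite mulr0.
  by apply: hX; rewrite normrM (ger0_norm c0) gtr_pMl// lt_def cn.
have [Ux Ix] := thU U r r0 Ur UM0.
have [Vy Iy] := thU V r' r'0 Vr VM0.
have -> : w = (1 - s) * (th * r) + s * (th * r').
  transitivity (th * rho); first by rewrite divfK// gt_eqF.
  by rewrite /rho; ring.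
split; first exact: UVW.
move: Ix Iy; rewrite /I /= !in_itv/= => /andP[a1 a2] /andP[b1 b2].
have := ler_wpM2l s0 b1; have := ler_wpM2l s0 b2.
have s1' : 0 <= 1 - s by lra.
have := ler_wpM2l s1' a1; have := ler_wpM2l s1' a2.
by move=> *; apply/andP; split; lra.
Qed.

End density.

(** * Hoelder inequalities *)

Lemma nneg_root (R : realType) (k : nat) (x : R) : (0 < k)%N -> 0 <= x ->
  exists2 r, 0 <= r & r ^+ k = x.
Proof.
move=> k0 x0; exists (x `^ k%:R^-1); first exact: powR_ge0.
by rewrite -powR_mulrn ?powR_ge0// -powRrM mulVf ?pnatr_eq0 -?lt0n// powRr1.
Qed.

Lemma exprn_le0 (R : realType) (k : nat) (x : R) : 0 <= x -> x ^+ k <= 0 -> x = 0.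
Proof.
move=> x0 xk; apply/eqP.
have : x ^+ k == 0 by rewrite eq_le xk exprn_ge0.
by rewrite expf_eq0 => /andP[].
Qed.

(** AM-GM for one copy of [x ^+ k.+1] and [k] copies of [y ^+ k.+1]. The inductive step multiplies
    by [x] and adds the square term [k.+1%:R * y ^+ k * (x - y) ^+ 2]. *)
Lemma weighted_AGM_nat (R : realType) (k : nat) (x y : R) : 0 <= x -> 0 <= y ->
  k.+1%:R * x * y ^+ k <= x ^+ k.+1 + k%:R * y ^+ k.+1.
Proof.
move=> x0 y0; elim: k => [|k IH]; first by rewrite !expr0 !expr1; lra.
have /(ler_wpM2l x0) h := IH.
have yk : 0 <= k.+1%:R * y ^+ k * (x - y) ^+ 2 
    by rewrite mulr_ge0 ?sqr_ge0// mulr_ge0// exprn_ge0.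
rewrite -subr_ge0; rewrite -subr_ge0 in h.
rewrite (_ : _ - _ = x * (x ^+ k.+1 + k%:R * y ^+ k.+1) - x * (k.+1%:R * x * y ^+ k)
  + k.+1%:R * y ^+ k * (x - y) ^+ 2); first exact: addr_ge0.
rewrite !exprS -!natr1; ring.
Qed.

(** Two-term Hoelder with exponents [(k+1)/k] and [k+1]. The function [c ^+ k.+1 / w ^+ k] is convex
    and homogeneous, hence subadditive in [(c, w)]. *)
Lemma hoelder2 (R : realType) (k : nat) (a b u v x y : R) :
  0 <= a -> 0 <= b -> 0 <= u -> 0 <= v -> 0 <= x -> 0 <= y ->
  a ^+ k.+1 <= u ^+ k * x -> b ^+ k.+1 <= v ^+ k * y ->
  (a + b) ^+ k.+1 <= (u + v) ^+ k * (x + y).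
Proof.
case: k => [|k] a0 b0 u0 v0 x0 y0 ha hb.
  by move: ha hb; rewrite !expr0 !expr1 !mul1r => ha hb; exact: lerD.
have [uv0|uv0] := eqVneq (u + v) 0.
  have u00 : u = 0 by lra.
  have v00 : v = 0 by lra.
  move: ha hb; rewrite u00 v00 expr0n !mul0r => ha hb.
  by rewrite (exprn_le0 a0 ha) (exprn_le0 b0 hb) !addr0 !expr0n mul0r.
(* Both terms are bounded below by the tangent plane of [c ^+ k.+2 / w ^+ k.+1] along the ray
   [c = r * w]. This plane is exact at [(Z, P)], so the two bounds add up to the claim. *)
set P := u + v; set Z := a + b; pose r := Z / P.
have P0 : 0 < P by rewrite lt_def /P uv0 addr_ge0.
have r0 : 0 <= r by rewrite divr_ge0 ?addr_ge0// ltW.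
have tangent c w z : 0 <= c -> 0 <= w -> 0 <= z -> c ^+ k.+2 <= w ^+ k.+1 * z ->
    k.+2%:R * c * r ^+ k.+1 - k.+1%:R * w * r ^+ k.+2 <= z.
  move=> c0 w0 z0 hc.
  have [w00|w00] := eqVneq w 0.
    move: hc; rewrite w00 expr0n mul0r => hc.
    by rewrite (exprn_le0 c0 hc) mulr0 !mul0r mulr0 mul0r subr0.
  have wk : 0 < w ^+ k.+1 by rewrite exprn_gt0// lt_def w00.
  rewrite -(ler_pM2l wk); apply: le_trans hc.
  have := weighted_AGM_nat k.+1 c0 (mulr_ge0 w0 r0).
  rewrite -lerBlDr; apply: le_trans.
  by rewrite !exprMn [w ^+ k.+2]exprS le_eqVlt; apply/orP; left; apply/eqP; ring.
have h := lerD (tangent _ _ _ a0 u0 x0 ha) (tangent _ _ _ b0 v0 y0 hb).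
apply: (le_trans _ (ler_wpM2l (exprn_ge0 k.+1 (ltW P0)) h)).
rewrite le_eqVlt; apply/orP; left; apply/eqP.
have Pr : P * r = Z by rewrite /r mulrC divfK// gt_eqF.
have rZ : r ^+ k.+1 * P ^+ k.+1 = Z ^+ k.+1 by rewrite -exprMn mulrC Pr.
transitivity (Z ^+ k.+1 * (k.+2%:R * Z - k.+1%:R * (P * r))).
  by rewrite Pr exprS -[k.+2%:R]natr1; ring.
rewrite -rZ /Z /P [r ^+ k.+2]exprS; ring.
Qed.

Section hoelder.
Context d (T : measurableType d) (R : realType) (m : {measure set T -> \bar R}).
Local Open Scope ereal_scope.

(** Hoelder for [#|A|] functions with equal exponents, reduced to pointwise AM-GM after normalising
    each [G i] by its integral. The bound [rho] avoids extracting a root. *)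
Lemma hoelder_prod (I : finType) (A : {pred I}) (c rho : R) (F : T -> R)
    (G : I -> T -> R) (J : I -> R) :
  (0 < #|A|)%N -> (0 <= c)%R -> (0 <= rho)%R ->
  measurable_fun setT F -> (forall i, measurable_fun setT (G i)) ->
  (forall x, 0 <= F x)%R -> (forall i x, 0 <= G i x)%R ->
  (forall i, \int[m]_x (G i x)%:E = (J i)%:E) ->
  (forall x, F x ^+ #|A| <= c * \prod_(i in A) G i x)%R ->
  (c * \prod_(i in A) J i <= rho ^+ #|A|)%R ->
  \int[m]_x (F x)%:E <= rho%:E.
Proof.
move=> A0 c0 rho0 mF mG F0 G0 JE FG cJ.
have J0 i : (0 <= J i)%R.
  by rewrite -lee_fin -JE; apply: integral_ge0 => x _; rewrite lee_fin.
(* A vanishing [J i] forbids the normalisation, but then [G i], and with it [F], is zero almost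
   everywhere. *)
have [[i iA Ji0]|Jpos] := pselect (exists2 i, i \in A & J i = 0%R).
  suff -> : \int[m]_x (F x)%:E = 0 by rewrite lee_fin.
  have : \int[m]_x `|(G i x)%:E| = 0.
    transitivity (J i)%:E; last by rewrite Ji0.
    rewrite -JE.
    by apply: eq_integral => x _; rewrite gee0_abs ?lee_fin.
  move/ae_eq_integral_abs => /(_ measurableT) h.
  rewrite (@ae_eq_integral _ _ _ m setT (cst 0) (EFin \o F)) ?integral0//.
  - exact/measurable_EFinP.
  - have mGi : measurable_fun setT (EFin \o G i) by exact/measurable_EFinP.
    have := h mGi.
    apply: filterS => x /= Gx _.
    have := FG x; rewrite (bigD1 i)//=.
    have [->] := Gx Logic.I.
    by rewrite mul0r mulr0 => /exprn_le0 ->.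
have {}Jpos i : i \in A -> (0 < J i)%R.
  by move=> iA; rewrite lt_def J0 andbT; apply/eqP => Ji; apply: Jpos; exists i.
pose N := #|A|.
have N0 : (0 < N%:R :> R)%R by rewrite ltr0n.
(* AM-GM for the ratios [G i x / J i]; each summand on the right integrates to [rho / N], so the sum
   integrates to [rho]. *)
have Fle x : (F x <= \sum_(i <- enum A) (rho / N%:R / J i) * G i x)%R.
  have S0 : (0 <= \sum_(i <- enum A) (rho / N%:R / J i) * G i x)%R.
    by apply: sumr_ge0 => i _; rewrite mulr_ge0// !divr_ge0// ltW.
  rewrite -(@ler_pXn2r _ N)// ?nnegrE//; apply: (le_trans (FG x)).
  rewrite [leRHS](_ : _ = rho ^+ N * ((\sum_(i in A) (G i x / J i)) / N%:R) ^+ N)%R; last first.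
    rewrite -exprMn big_enum/=; congr (_ ^+ _)%R.
    by rewrite mulr_suml mulr_sumr; apply: eq_bigr => i _; ring.
  have AGM := @leif_AGM R I A (fun i => G i x / J i)%R.
  have {AGM} [|AGM _] := AGM.
    by move=> i iA; rewrite divr_ge0.
  rewrite prodf_div in AGM.
  apply: (@le_trans _ _ (rho ^+ N * ((\prod_(i in A) G i x) / \prod_(i in A) J i))%R); last first.
    by rewrite ler_wpM2l// exprn_ge0.
  rewrite mulrA ler_pdivlMr; last by apply: prodr_gt0 => i; exact: Jpos.
  rewrite mulrAC ler_wpM2r//.
  by apply: prodr_ge0.
apply: (@le_trans _ _ (\int[m]_x \sum_(i <- enum A) ((rho / N%:R / J i) * G i x)%:E)).
  apply: ge0_le_integral => //.
  - by move=> x _; rewrite lee_fin.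
  - exact/measurable_EFinP.
  - apply: emeasurable_sum => i; apply/measurable_EFinP.
    exact: measurable_funM.
  - by move=> x _; rewrite sumEFin lee_fin.
rewrite ge0_integral_sum//; last 2 first.
- by move=> i; apply/measurable_EFinP; exact: measurable_funM.
- by move=> i x _; rewrite lee_fin mulr_ge0// !divr_ge0// ltW.
rewrite (eq_big_seq (fun=> (rho / N%:R)%:E)); last first.
  move=> i; rewrite mem_enum => iA.
  under eq_integral do rewrite EFinM.
  rewrite ge0_integralZl//; last 3 first.
  - exact/measurable_EFinP.
  - by move=> x _; rewrite lee_fin.
  - by rewrite lee_fin !divr_ge0// ltW.
  by rewrite JE -EFinM divfK// gt_eqF// Jpos.
rewrite sumEFin big_enum/= sumr_const -/N lee_fin -[leLHS]mulr_natr divfK//.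
by rewrite gt_eqF.
Qed.
End hoelder.

(** * Brunn-Minkowski inequality for solid sets *)

Lemma measurable_ler_set d (T : measurableType d) (R : realType) (f g : T -> R) :
  measurable_fun setT f -> measurable_fun setT g ->
  measurable [set x | f x <= g x].
Proof.
move=> mf mg; have mt : measurable [set true] by [].
have := measurable_fun_ler mf mg measurableT mt.
by rewrite setTI; congr measurable; apply/seteqP; split=> x /=.
Qed.

Section layer_cake.
Context d (T : measurableType d) (R : realType) (m : {finite_measure set T -> \bar R}).
Local Notation Rm := (measurableTypeR R).
Local Notation lambda := (@lebesgue_measure R).
Local Open Scope ereal_scope.

(** Tonelli on the subgraph of [f]. The weight [w] is constant for integrals and [power_weight] for
    moments. *)
Lemma layer_cake (f : T -> R) (D : set Rm) (w : R -> \bar R) :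
  measurable_fun setT f -> measurable D -> measurable_fun setT w ->
  (forall t, 0 <= w t) ->
  \int[m]_x \int[lambda]_(t in D `&` [set t | (t <= f x)%R]) w t =
  \int[lambda]_(t in D) (w t * m [set x | (t <= f x)%R]).
Proof.
move=> mf mD mw w0.
pose E : set (T * Rm) := [set z | D z.2 /\ (z.2 <= f z.1)%R].
have mE : measurable E.
  apply: (@measurableI _ _ (snd @^-1` D)).
    by rewrite -[X in measurable X]setTI; exact: measurable_snd.
  by apply: measurable_ler_set => //; exact: measurableT_comp.
pose k (z : T * Rm) := w z.2 * (\1_E z)%:E.
have mk : measurable_fun setT k.
  apply: emeasurable_funM; first exact: measurableT_comp.
  by apply/measurable_EFinP; exact: measurable_indic.
have k0 z : 0 <= k z by rewrite mule_ge0// lee_fin.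
have := @fubini_tonelli _ _ _ _ _ m lambda _ mk k0.
rewrite (_ : \int[m]_x _ =
    \int[m]_x \int[lambda]_(t in D `&` [set t | (t <= f x)%R]) w t); last first.
  apply: eq_integral => x _; rewrite [RHS]integral_mkcond; apply: eq_integral => t _.
  rewrite /k patchE indicE; case: ifPn => [|].
    by rewrite inE => tE; rewrite mem_set ?mule1.
  by rewrite notin_setE => tE; rewrite memNset ?mule0.
move=> ->; rewrite [RHS]integral_mkcond; apply: eq_integral => t _.
have mt : measurable [set x | (t <= f x)%R] by exact: measurable_ler_set.
rewrite /k patchE /=; case: ifPn => [|].
  rewrite inE => tD.
  rewrite ge0_integralZl//; last first.
    apply/measurable_EFinP.
    have mi : measurable_fun setT (\1_E : T * Rm -> R) by exact: measurable_indic.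
    exact: (measurableT_comp mi (pair2_measurable (t : Rm))).
  congr (_ * _).
  rewrite -[X in m X]setIT -integral_indic//; apply: eq_integral => x _.
  by rewrite !indicE; congr (_%:R)%:E; congr nat_of_bool; apply/idP/idP; rewrite !inE /E/=; tauto.
rewrite notin_setE => tD; rewrite integral0_eq// => x _.
by rewrite indicE memNset ?mule0// => -[].
Qed.

(** Levels are parametrised by the relative height [t] in ]0, 1], which yields the integral of
    [min(c, f)]. Equality serves functions whose maximum is [c]; the inequality serves the target
    function, whose maximum may exceed [c]. *)
Lemma layer_cake_unit (f : T -> R) (c : R) : measurable_fun setT f ->
  (forall x, 0 <= f x)%R -> (0 < c)%R ->
  c%:E * \int[lambda]_(t in `]0%R, 1%R]) m [set x | (c * t <= f x)%R] <= \int[m]_x (f x)%:E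
  /\ ((forall x, f x <= c)%R ->
  c%:E * \int[lambda]_(t in `]0%R, 1%R]) m [set x | (c * t <= f x)%R] = \int[m]_x (f x)%:E).
Proof.
move=> mf f0 c0.
have mfc : measurable_fun setT (fun x => f x / c)%R by exact: measurable_funM.
have -> : \int[lambda]_(t in `]0%R, 1%R]) m [set x | (c * t <= f x)%R] =
    \int[lambda]_(t in `]0%R, 1%R]) (cst 1 t * m [set x | (t <= f x / c)%R]).
  apply: eq_integral => t _; rewrite mul1e; congr (m _); apply/seteqP; split=> x /=;
  by rewrite ler_pdivlMr// mulrC.
rewrite -layer_cake//.
have mI x : measurable (`]0%R, 1%R]%classic `&` [set t : Rm | (t <= f x / c)%R]).
  apply: measurableI; first exact: measurable_itv.
  rewrite (_ : [set t | _] = `]-oo, (f x / c)%R]%classic); first exact: measurable_itv.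
  by apply/seteqP; split=> t; rewrite /= in_itv.
have inner x : \int[lambda]_(t in `]0%R, 1%R] `&` [set t : Rm | (t <= f x / c)%R]) cst 1 t =
    (Num.min 1 (c^-1 * f x))%:E.
  rewrite integral_cst ?mul1e; last exact: mI.
  rewrite (_ : _ `&` _ = `]0%R, Num.min 1%R (f x / c)%R]%classic); last first.
    apply/seteqP; split=> t /=; rewrite !in_itv/= le_min.
      by move=> [/andP[-> ->] ->].
    by move=> /and3P[-> -> ->].
  rewrite /= lebesgue_measure_itv/= lte_fin mulrC; case: ltP => [h|h].
    by rewrite -EFinB subr0.
  by congr EFin; apply/eqP; rewrite eq_le h le_min ler01 mulr_ge0// invr_ge0 ltW.
rewrite (eq_integral _ _ (fun x _ => inner x)).
have -> : \int[m]_x (f x)%:E = c%:E * \int[m]_x (c^-1 * f x)%:E.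
  under [in RHS]eq_integral do rewrite EFinM.
  rewrite ge0_integralZl//; last 3 first.
  - exact/measurable_EFinP.
  - by move=> x _; rewrite lee_fin.
  - by rewrite lee_fin invr_ge0 ltW.
  by rewrite muleA -EFinM divff ?mul1e// gt_eqF.
have mf1 : measurable_fun setT (fun x => c^-1 * f x)%R by exact: measurable_funM.
split=> [|fc].
  apply: lee_wpmul2l; first by rewrite lee_fin ltW.
  apply: ge0_le_integral => //.
  - by move=> x _; rewrite lee_fin le_min ler01 mulr_ge0// invr_ge0 ltW.
  - by apply/measurable_EFinP; exact: measurable_minr.
  - exact/measurable_EFinP.
  - by move=> x _; rewrite lee_fin ge_min lexx orbT.
congr (_ * _); apply: eq_integral => x _; congr EFin.
by apply/min_idPr; rewrite mulrC ler_pdivrMr// mul1r.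
Qed.
End layer_cake.

Section functional.
Context (R : realType) (m : {finite_measure set (measurableTypeR R) -> \bar R}).
Hypothesis hm : concave_on_solid m.
Local Notation Rm := (measurableTypeR R).
Local Notation lambda := (@lebesgue_measure R).
Local Open Scope ereal_scope.

(** Intersecting with [P] matters when [e = 0]: for a nonnegative [f] the other condition is then
    vacuous. *)
Let level (P : set Rm) (f : Rm -> R) (e : R) (t : R) : set Rm :=
  P `&` [set x | (e * t <= f x)%R].

Let measurable_level P f e t : measurable P -> measurable_fun setT f ->
  measurable (level P f e t).
Proof. by move=> mP mf; apply: measurableI => //; exact: measurable_ler_set. Qed.

Let measurable_fun_level P f e : measurable P -> measurable_fun setT f ->
  measurable_fun setT (fun t : Rm => m (level P f e t)).
Proof.
move=> mP mf; pose E : set (Rm * Rm) := [set z | level P f e z.1 z.2].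
have mE : measurable E.
  apply: (@measurableI _ _ (snd @^-1` P)).
    by rewrite -[X in measurable X]setTI; exact: measurable_snd.
  apply: measurable_ler_set; last exact: measurableT_comp.
  exact: measurable_funM.
have := measurable_fun_xsection m mE.
congr measurable_fun; apply/funext => t /=; congr (m _).
by apply/seteqP; split=> x; rewrite /xsection/= inE.
Qed.

(** The maximum of [f] is at 0, so its integral is the height [f 0] times the mean measure [r] of
    the levels at relative heights; for [f 0 = 0] the function vanishes and so does [a ^+ k.+1]. *)
Let level_integral (P : set Rm) (f : Rm -> R) (a : R) k : measurable P -> measurable_fun setT f ->
  (forall x, 0 <= f x)%R -> (forall x, ~ P x -> f x = 0%R) ->
  (forall x y : R, `|x| <= `|y| -> f y <= f x)%R -> (0 <= a)%R ->
  (a ^+ k.+1)%:E <= \int[m]_x (f x)%:E ->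
  exists r : R, [/\ (0 <= r)%R, (a ^+ k.+1 <= f 0%R * r)%R &
    \int[lambda]_(t in `]0%R, 1%R]) m (level P f (f 0%R) t) = r%:E].
Proof.
move=> mP mf f0 fP fdec a0 af.
have mlev : measurable_fun (`]0%R, 1%R]%classic : set Rm) (fun t : Rm => m (level P f (f 0%R) t)).
  exact: measurable_funTS (measurable_fun_level _ mP mf).
have fin : \int[lambda]_(t in `]0%R, 1%R]) m (level P f (f 0%R) t) \is a fin_num.
  rewrite ge0_fin_numE; last exact: integral_ge0.
  apply: (@le_lt_trans _ _ (\int[lambda]_(t in `]0%R, 1%R]) cst (m setT) t)).
    apply: ge0_le_integral => //.
    by move=> t _; apply: le_measure; rewrite ?inE//; exact: measurable_level.
  rewrite integral_cst//= lebesgue_measure_itv/= lte01 -EFinB subr0 mule1.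
  by rewrite -ge0_fin_numE// fin_num_measure.
exists (fine (\int[lambda]_(t in `]0%R, 1%R]) m (level P f (f 0%R) t))); split.
- by apply: fine_ge0; exact: integral_ge0.
- have [f00|f00] := eqVneq (f 0%R) 0%R.
    rewrite f00 mul0r -lee_fin (le_trans af)// integral0_eq// => x _.
    by congr EFin; apply/eqP; rewrite eq_le f0 -f00 fdec// normr0.
  have f0p : (0 < f 0%R)%R by rewrite lt_def f00 f0.
  have [_ h] := layer_cake_unit m mf f0 f0p.
  rewrite -lee_fin (le_trans af)// -h; last by move=> x; rewrite fdec// normr0.
  rewrite EFinM fineK//; apply: lee_wpmul2l; first by rewrite lee_fin.
  rewrite le_eqVlt; apply/orP; left; apply/eqP; apply: eq_integral => t.
  rewrite inE/= in_itv/= => /andP[t0 _]; congr (m _); apply/seteqP; split=> x //=.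
    move=> h'; split=> //; apply: contrapT => /fP fx0.
    by move: h'; rewrite fx0 leNgt mulr_gt0.
  by case.
- by rewrite fineK.
Qed.

(** Levels of [a] and [b] are compared at the same relative height [t], not the same height.
    Concavity of [m] bounds the level of [c] for each [t]; integrating gives the combined widths,
    and [hoelder2] multiplies them by the combined heights, raising the exponent from [k] to
    [k.+1]. *)
Lemma functional_brunn_minkowski (k : nat) (s al be : R)
    (PA PB : set Rm) (a b c : Rm -> R) :
  (0 < k)%N -> (0 <= s <= 1)%R -> (0 <= al)%R -> (0 <= be)%R ->
  measurable PA -> measurable PB -> measurable_fun setT a ->
  measurable_fun setT b -> measurable_fun setT c ->
  (forall x, 0 <= a x)%R -> (forall x, 0 <= b x)%R -> (forall x, 0 <= c x)%R ->
  solid1 PA -> solid1 PB -> PA 0%R -> PB 0%R ->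
  (forall x, ~ PA x -> a x = 0%R) -> (forall x, ~ PB x -> b x = 0%R) ->
  (forall x y : R, `|x| <= `|y| -> a y <= a x)%R ->
  (forall x y : R, `|x| <= `|y| -> b y <= b x)%R ->
  (forall x y u v, PA x -> PB y -> 0 <= u -> 0 <= v -> u ^+ k <= a x -> v ^+ k <= b y ->
     ((1 - s) * u + s * v) ^+ k <= c ((1 - s) * x + s * y))%R ->
  (al ^+ k.+1)%:E <= \int[m]_x (a x)%:E ->
  (be ^+ k.+1)%:E <= \int[m]_x (b x)%:E ->
  (((1 - s) * al + s * be) ^+ k.+1)%:E <= \int[m]_x (c x)%:E.
Proof.
move=> k0 /andP[s0 s1] al0 be0 mPA mPB ma mb mc a0 b0 c0 sA sB A0 B0 aP bP adec bdec abc ha hb.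
have [ra [ra0 hra Ia]] := level_integral mPA ma a0 aP adec al0 ha.
have [rb [rb0 hrb Ib]] := level_integral mPB mb b0 bP bdec be0 hb.
have [u u0 ua] := nneg_root k0 (a0 0%R).
have [v v0 vb] := nneg_root k0 (b0 0%R).
have s1' : (0 <= 1 - s)%R by rewrite subr_ge0.
pose M := ((1 - s) * u + s * v)%R.
have M0 : (0 <= M)%R by rewrite addr_ge0// mulr_ge0.
(* [M ^+ k] is the height guaranteed for [c] at 0, and [ra], [rb] are the mean widths of [a] and
   [b]. *)
apply: (@le_trans _ _ (M ^+ k * ((1 - s) * ra + s * rb))%:E).
  rewrite lee_fin; apply: hoelder2; rewrite ?mulr_ge0//.
  - rewrite -ua in hra; have := ler_wpM2l (exprn_ge0 k.+1 s1') hra.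
    by rewrite !exprMn [((1 - s) ^+ k.+1)%R in leRHS]exprS =>
      /le_trans; apply; rewrite le_eqVlt; apply/orP; left; apply/eqP; ring.
  - rewrite -vb in hrb; have := ler_wpM2l (exprn_ge0 k.+1 s0) hrb.
    by rewrite !exprMn [(s ^+ k.+1)%R in leRHS]exprS =>
      /le_trans; apply; rewrite le_eqVlt; apply/orP; left; apply/eqP; ring.
have [Mk0|Mk0] := eqVneq (M ^+ k)%R 0%R.
  by rewrite Mk0 mul0r; apply: integral_ge0 => x _; rewrite lee_fin.
have Mkp : (0 < M ^+ k)%R by rewrite lt_def Mk0 exprn_ge0.
have [hc _] := layer_cake_unit m mc c0 Mkp.
apply: le_trans hc; rewrite EFinM; apply: lee_wpmul2l; first by rewrite lee_fin ltW.
have mla : measurable_fun (`]0%R, 1%R]%classic : set Rm) (fun t : Rm => m (level PA a (a 0%R) t)).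
  exact: measurable_funTS (measurable_fun_level _ mPA ma).
have mlb : measurable_fun (`]0%R, 1%R]%classic : set Rm) (fun t : Rm => m (level PB b (b 0%R) t)).
  exact: measurable_funTS (measurable_fun_level _ mPB mb).
have -> : ((1 - s) * ra + s * rb)%:E = \int[lambda]_(t in `]0%R, 1%R])
    ((1 - s)%:E * m (level PA a (a 0%R) t) + s%:E * m (level PB b (b 0%R) t)).
  rewrite ge0_integralD//; last 4 first.
  - by move=> t _; rewrite mule_ge0// ?lee_fin.
  - exact: measurable_funeM.
  - by move=> t _; rewrite mule_ge0// ?lee_fin.
  - exact: measurable_funeM.
  rewrite !ge0_integralZl//.
  by rewrite Ia Ib -!EFinM -EFinD.
apply: ge0_le_integral => //.
- by move=> t _; rewrite adde_ge0// mule_ge0// ?lee_fin.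
- by apply: emeasurable_funD; exact: measurable_funeM.
- apply: measurable_funTS.
  have := measurable_fun_level (M ^+ k)%R measurableT mc.
  by congr measurable_fun; apply/funext => t; rewrite /level setTI.
move=> t; rewrite /= in_itv/= => /andP[t0 t1].
apply: hm => //.
- exact: measurable_level.
- exact: measurable_level.
- apply: measurable_ler_set => //.
- move=> x y [Py ay] xy; split; first exact: sA xy.
  exact: le_trans ay (adec _ _ xy).
- move=> x y [Py ay] xy; split; first exact: sB xy.
  exact: le_trans ay (bdec _ _ xy).
- by split=> //=; rewrite ler_piMr.
- by split=> //=; rewrite ler_piMr.
move=> x y [Px ax] [Py by_] /=.
(* In terms of [k]-th roots, relative height [t] scales [u] and [v] by the common factor [r], hence
   also their combination [M]. *)
have [r r0 rt] := nneg_root k0 (ltW t0).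
have := abc x y (u * r)%R (v * r)%R Px Py (mulr_ge0 u0 r0) (mulr_ge0 v0 r0).
rewrite !exprMn ua vb rt => /(_ ax by_).
rewrite (_ : (1 - s) * (u * r) + s * (v * r) = M * r)%R; last by rewrite /M; ring.
by rewrite exprMn rt.
Qed.
End functional.

Section solid_sets.
Context (R : realType) (n : nat).
Local Notation Rm := (measurableTypeR R).
Local Notation T := (n.-tuple (measurableTypeR R)).

Definition solid (A : set T) : Prop :=
  forall x y : T, A y -> (forall k, `|tnth x k : R| <= `|tnth y k : R|) -> A x.

Definition zero_tuple : T := [tuple 0 | _ < n].

Definition upd (j : 'I_n) (t : R) (y : T) : T :=
  [tuple if k == j then t else tnth y k | k < n].

Definition comb (s : R) (x y : T) : T :=
  [tuple (1 - s) * (tnth x k : R) + s * tnth y k | k < n].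

(** The slice remains a set of [n]-tuples and ignores their [j]-th entry, so inductions on [S] need
    no reindexing. *)
Definition slice (j : 'I_n) (A : set T) (t : R) : set T := [set y | A (upd j t y)].

Lemma solid_zero A x : solid A -> A x -> A zero_tuple.
Proof. by move=> sA /sA; apply=> k; rewrite tnth_mktuple normr0. Qed.

Lemma solid_slice j A t : solid A -> solid (slice j A t).
Proof.
move=> sA x y Ay xy; apply: sA Ay _ => k; rewrite !tnth_mktuple.
by case: eqP.
Qed.

Lemma slice_dec j A t u : solid A -> `|t| <= `|u| -> slice j A u `<=` slice j A t.
Proof.
move=> sA tu y Ay; apply: sA Ay _ => k; rewrite !tnth_mktuple.
by case: eqP.
Qed.

Lemma upd_id j (y : T) : tnth y j = 0 -> upd j 0 y = y.
Proof.
move=> yj; apply: eq_from_tnth => k; rewrite tnth_mktuple.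
by case: eqP => // ->.
Qed.

Lemma upd_zero j : upd j 0 zero_tuple = zero_tuple.
Proof. by apply: upd_id; rewrite tnth_mktuple. Qed.

Lemma comb_zero s : comb s zero_tuple zero_tuple = zero_tuple.
Proof.
by apply: eq_from_tnth => k; rewrite !tnth_mktuple !mulr0 addr0.
Qed.

Lemma comb_upd j s t u x y :
  comb s (upd j t x) (upd j u y) = upd j ((1 - s) * t + s * u) (comb s x y).
Proof.
by apply: eq_from_tnth => k; rewrite !tnth_mktuple; case: eqP.
Qed.

Lemma measurable_upd j : measurable_fun [set: Rm * T] (fun p => upd j p.1 p.2).
Proof.
apply/measurable_fun_tnthP => k; have [kj|kj] := eqVneq k j.
  rewrite (_ : _ \o _ = fst) //.
  by apply/funext => p /=; rewrite tnth_mktuple kj eqxx.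
rewrite (_ : _ \o _ = (fun p => tnth p.2 k)).
  exact: (measurableT_comp (measurable_tnth k) measurable_snd).
by apply/funext => p /=; rewrite tnth_mktuple (negbTE kj).
Qed.

Lemma measurable_slice j A t : measurable A -> measurable (slice j A t).
Proof.
move=> mA; have := measurableT_comp (measurable_upd j) (pair1_measurable (t : Rm)).
by move=> /(_ measurableT _ mA); rewrite setTI.
Qed.

Lemma measurable_slice0 j A : measurable A ->
  measurable ([set t | A (upd j t zero_tuple)] : set Rm).
Proof.
move=> mA; have := measurableT_comp (measurable_upd j) (pair2_measurable zero_tuple).
by move=> /(_ measurableT _ mA); rewrite setTI.
Qed.

Variable mu : 'I_n -> {finite_measure set Rm -> \bar R}.

Lemma coord_measure_finE S A : measurable A ->
  coord_measure mu S A = (fine (coord_measure mu S A))%:E.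
Proof. by move=> mA; rewrite fineK// fin_num_measure. Qed.

Lemma measurable_nu_slice j S A : measurable A ->
  measurable_fun [set: Rm] (fun t => coord_measure mu S (slice j A t)).
Proof.
move=> mA; pose E := (fun p => upd j p.1 p.2) @^-1` A.
have mE : measurable E by rewrite -[X in measurable X]setTI; exact: measurable_upd.
have := measurable_fun_xsection (coord_measure mu S) mE.
congr measurable_fun; apply/funext => t /=; congr (coord_measure mu S _).
by apply/seteqP; split=> y; rewrite /xsection/= inE.
Qed.

Lemma measurable_vol_slice j S A : measurable A ->
  measurable_fun [set: Rm] (fun t => fine (coord_measure mu S (slice j A t))).
Proof. by move=> mA; apply: measurableT_comp => //; exact: measurable_nu_slice. Qed.

Lemma coord_measure_slice (j : 'I_n) (S : {set 'I_n}) (A : set T) : j \notin S -> measurable A ->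
  coord_measure mu (j |: S)%SET A = (\int[mu j]_t coord_measure mu S (slice j A t))%E.
Proof.
move=> jS mA; rewrite coord_measure_merge//; last by move=> k /set1P ->.
have mj : measurable_fun [set: T] (fun x : T => tnth x j) := measurable_tnth j.
transitivity (\int[coord_measure mu [set j]%SET]_x
   ((fun t => coord_measure mu S (slice j A t)) \o (fun x : T => tnth x j)) x)%E.
  apply: eq_integral => x _; congr (coord_measure mu S _).
  apply/seteqP; split=> y; rewrite /slice /=;
  rewrite (_ : merge _ x y = upd j (tnth x j) y)//; apply: eq_from_tnth => k;
  by rewrite !tnth_mktuple inE; case: eqP => // ->.
have := ge0_integral_pushforward mj (coord_measure mu [set j]%SET) measurableT
  (measurable_nu_slice j S mA).
rewrite preimage_setT => <-; last by move=> t _; exact: measure_ge0.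
apply: eq_measure_integral => X mX _; exact: coord_measure_marginal.
Qed.

Lemma int_vol_slice (j : 'I_n) (S : {set 'I_n}) (A : set T) : j \notin S -> measurable A ->
  (\int[mu j]_t (fine (coord_measure mu S (slice j A t)))%:E)%E =
  (fine (coord_measure mu (j |: S)%SET A))%:E.
Proof.
move=> jS mA; rewrite -coord_measure_finE// coord_measure_slice//; apply: eq_integral => t _.
by rewrite -coord_measure_finE//; exact: measurable_slice.
Qed.

(** For [j] outside [S] the measure sees only the central slice of [A], which contains every
    parallel slice by solidity. *)
Lemma coord_measure_slice_le (j : 'I_n) (S : {set 'I_n}) (A : set T) (t : R) :
  j \notin S -> measurable A -> solid A ->
  (coord_measure mu S (slice j A t) <= coord_measure mu S A)%E.
Proof.
move=> jS mA sA; rewrite (@coord_measure_supp _ _ mu S A (slice j A 0)).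
  apply: le_measure; rewrite ?inE; try exact: measurable_slice.
  by apply: slice_dec => //; rewrite normr0.
by move=> y y0; rewrite /slice /= upd_id// y0.
Qed.

Hypothesis hmu : forall k, concave_on_solid (mu k).

(* Stated without #|S|-th roots, so that it also makes sense for empty [S]. *)
Lemma brunn_minkowski (S : {set 'I_n}) (s al be : R) (A B C : set T) :
  0 <= s <= 1 -> 0 <= al -> 0 <= be ->
  measurable A -> measurable B -> measurable C -> solid A -> solid B ->
  A zero_tuple -> B zero_tuple ->
  (forall x y, A x -> B y -> C (comb s x y)) ->
  ((al ^+ #|S|)%:E <= coord_measure mu S A)%E -> ((be ^+ #|S|)%:E <= coord_measure mu S B)%E ->
  ((((1 - s) * al + s * be) ^+ #|S|)%:E <= coord_measure mu S C)%E.
Proof.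
move=> s01.
have [N] := ubnP #|S|; elim: N => // N IH in S al be A B C *; rewrite ltnS => SN.
move=> al0 be0 mA mB mC sA sB A0 B0 ABC.
have [->|[j jS]] := set_0Vmem S.
  rewrite !cards0 !expr0 => _ _.
  rewrite coord_measure_set0 indicE mem_set//.
  by rewrite -[X in C X](comb_zero s); exact: ABC.
have jS' : j \notin (S :\ j)%SET by rewrite !inE eqxx.
rewrite -(finset.setD1K jS) cardsU1 jS' add1n.
have S'N : (#|S :\ j| < N)%N.
  by move: SN; rewrite (cardsD1 j S) jS.
set S' := (S :\ j)%SET in jS' S'N *.
(* By solidity, for a solid [X] these are exactly the [t] whose slice is nonempty. *)
pose P (X : set T) : set Rm := [set t | X (upd j t zero_tuple)].
have mP X : measurable X -> measurable (P X) by exact: measurable_slice0.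
have sP X : solid X -> solid1 (P X).
  move=> sX x y Py xy; apply: sX Py _ => k; rewrite !tnth_mktuple.
  by case: eqP.
have P0 X : X zero_tuple -> P X 0 by move=> X0; rewrite /P /= upd_zero.
have PC x y : P A x -> P B y -> P C ((1 - s) * x + s * y).
  by move=> Ax By; rewrite /P /= -[X in upd _ _ X](comb_zero s) -comb_upd; exact: ABC.
(* With [j] the only coordinate, concavity of [mu j] applies directly; [functional_brunn_minkowski]
   starts from a positive exponent. *)
have [k0|kpos] := posnP #|S'|.
  have {k0} S'0 : S' = finset.set0 by apply: cards0_eq.
  have nuP X : measurable X -> coord_measure mu (j |: S')%SET X = mu j (P X).
    move=> mX; rewrite S'0 coord_measure_slice ?inE//.
    under eq_integral do rewrite coord_measure_set0.
    by rewrite integral_indic ?setIT//; exact: mP.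
  rewrite !nuP// S'0 cards0 !expr1 => ha hb.
  have /andP[s0 s1] := s01.
  have s1' : 0 <= 1 - s by rewrite subr_ge0.
  apply: le_trans (@hmu j s (P A) (P B) (P C) s0 s1 (mP _ mA) (mP _ mB) (mP _ mC)
    (sP _ sA) (sP _ sB) (P0 _ A0) (P0 _ B0) PC).
  rewrite [leLHS]EFinD !EFinM; apply: leeD; apply: lee_wpmul2l => //.
have nuI X : measurable X -> coord_measure mu (j |: S')%SET X =
    (\int[mu j]_t (fine (coord_measure mu S' (slice j X t)))%:E)%E.
  by move=> mX; rewrite int_vol_slice// -coord_measure_finE.
rewrite (nuI A mA) (nuI B mB) (nuI C mC).
have vol0 X (t : Rm) : solid X -> ~ P X t -> fine (coord_measure mu S' (slice j X t)) = 0.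
  move=> sX PXt; rewrite (_ : slice j X t = set0) ?measure0//.
  by apply/seteqP; split=> y // yX; apply: PXt; exact: solid_zero (solid_slice sX) yX.
have vold X (x y : R) : measurable X -> solid X -> `|x| <= `|y| ->
    fine (coord_measure mu S' (slice j X y)) <= fine (coord_measure mu S' (slice j X x)).
  move=> mX sX xy; rewrite -lee_fin -!coord_measure_finE; try exact: measurable_slice.
  apply: le_measure; rewrite ?inE; try exact: measurable_slice.
  exact: slice_dec.
apply: (@functional_brunn_minkowski R (mu j) (hmu j) #|S'| s al be (P A) (P B)) => //.
- exact: mP.
- exact: mP.
- exact: measurable_vol_slice.
- exact: measurable_vol_slice.
- exact: measurable_vol_slice.
- by move=> x; apply: fine_ge0; exact: measure_ge0.
- by move=> x; apply: fine_ge0; exact: measure_ge0.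
- by move=> x; apply: fine_ge0; exact: measure_ge0.
- exact: sP.
- exact: sP.
- exact: P0.
- exact: P0.
- by move=> x; exact: vol0.
- by move=> x; exact: vol0.
- by move=> x y; exact: vold.
- by move=> x y; exact: vold.
move=> x y u v Px Py u0 v0; rewrite -!lee_fin -!coord_measure_finE; try exact: measurable_slice.
move=> hu hv.
(* The hypothesis on levels in the functional inequality is the induction hypothesis for parallel
   slices. *)
apply: (IH S' u v (slice j A x) (slice j B y)) => //; try exact: measurable_slice.
- exact: solid_slice.
- exact: solid_slice.
- by move=> y1 y2 Ay1 By2; rewrite /slice /= -comb_upd; exact: ABC.
Qed.

End solid_sets.

(** * Loomis-Whitney inequality for solid sets *)

(** The braces denote a classical set, as in [uniform_cover]. *)
Lemma card_classical_set (m : nat) (P : pred 'I_m) : #|[set i | P i]| = #|P|.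
Proof.
apply: eq_card; move=> /= i.
by apply/idP/idP => [/asboolP//|h]; exact/asboolP.
Qed.

Section loomis_whitney.
Context (R : realType) (n : nat).
Local Notation Rm := (measurableTypeR R).
Local Notation T := (n.-tuple (measurableTypeR R)).
Variable mu : 'I_n -> {finite_measure set Rm -> \bar R}.
Local Notation vol S A := (fine (coord_measure mu S A)).

(** Induction on [S] by slicing along one coordinate [j]. Exactly [k] of the sets [tau i] contain
    [j], so Hoelder for [k] functions of the slice position applies. *)
Lemma loomis_whitney (m k : nat) (tau : 'I_m -> {set 'I_n}) (S : {set 'I_n}) (A : set T) :
  (0 < k)%N -> measurable A -> solid A -> A (zero_tuple R n) ->
  (forall j, j \in S -> #|[set i | j \in tau i]| = k) ->
  vol S A ^+ k <= \prod_(i < m) vol (tau i :&: S) A.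
Proof.
move=> k0; have [N] := ubnP #|S|; elim: N => // N IH in S A *; rewrite ltnS => SN.
move=> mA sA A0 cover.
have vol_ge0 S' X : 0 <= vol S' X by apply: fine_ge0; exact: measure_ge0.
have [->|[j jS]] := set_0Vmem S.
  have vol0 : vol finset.set0 A = 1 by rewrite coord_measure_set0 indicE mem_set.
  rewrite vol0 expr1n big1// => i _.
  by rewrite finset.setI0 vol0.
have jS' : j \notin (S :\ j)%SET by rewrite !inE eqxx.
have SE := finset.setD1K jS.
have S'N : (#|S :\ j| < N)%N by move: SN; rewrite (cardsD1 j S) jS.
set S' := (S :\ j)%SET in jS' SE S'N *.
have jtau i : j \notin (tau i :&: S')%SET by rewrite inE (negbTE jS') andbF.
have tauS i : (tau i :&: S)%SET =
    if j \in tau i then (j |: (tau i :&: S'))%SET else (tau i :&: S')%SET.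
  apply/setP => l; rewrite -SE; case: ifP => ji; rewrite !inE; case: eqP => [->|_] //=;
  by rewrite ji.
(* Sets [tau i] avoiding [j] contribute slice volumes, each at most the corresponding volume of [A];
   their product becomes the constant in Hoelder. *)
pose c := \prod_(i < m | j \notin tau i) vol (tau i :&: S') A.
have c0 : 0 <= c by apply: prodr_ge0.
pose J i := vol (j |: (tau i :&: S')) A.
have card_j : #|[pred i | j \in tau i]| = k.
  by rewrite -(cover j jS) (card_classical_set (fun i => j \in tau i)).
have [rho rho0 rhoE] : exists2 rho, 0 <= rho & rho ^+ k = c * \prod_(i < m | j \in tau i) J i.
  apply: nneg_root => //; rewrite mulr_ge0//.
  by apply: prodr_ge0 => i _; exact: vol_ge0.
have -> : \prod_(i < m) vol (tau i :&: S) A = rho ^+ k.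
  rewrite rhoE mulrC (bigID (fun i => j \in tau i))/=; congr (_ * _).
    by apply: eq_bigr => i ji; rewrite tauS ji.
  by apply: eq_bigr => i ji; rewrite tauS (negbTE ji).
rewrite lerXn2r// ?nnegrE//.
rewrite -lee_fin -SE -int_vol_slice//.
apply: (@hoelder_prod _ _ _ (mu j) _ [pred i | j \in tau i] c rho _
  (fun i t => vol (tau i :&: S') (slice j A t)) J) => //.
- by rewrite card_j.
- exact: measurable_vol_slice.
- by move=> i; exact: measurable_vol_slice.
- by move=> i; rewrite int_vol_slice.
- move=> t; rewrite card_j; have [At|At] := pselect (slice j A t (zero_tuple R n)).
    apply: (@le_trans _ _ (\prod_(i < m) vol (tau i :&: S') (slice j A t))).
      apply: IH => //; first exact: measurable_slice.
        exact: solid_slice.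
      by move=> l; rewrite !inE => /andP[_]; exact: cover.
    rewrite (bigID (fun i => j \in tau i))/= mulrC ler_wpM2r//.
      by apply: prodr_ge0 => i _; exact: vol_ge0.
    apply: ler_prod => i _; rewrite vol_ge0/=.
    rewrite -lee_fin -!coord_measure_finE//; last exact: measurable_slice.
    exact: coord_measure_slice_le.
  rewrite (_ : slice j A t = set0); last first.
    by apply/seteqP; split=> y // Ay; apply: At; exact: solid_zero (solid_slice sA) Ay.
  rewrite measure0/= expr0n eqn0Ngt k0 mulr_ge0//; apply: prodr_ge0 => i _.
  by apply: fine_ge0; exact: measure_ge0.
- by rewrite card_j rhoE.
Qed.
End loomis_whitney.

(** * Berwald inequality *)

Section power_integrals.
Context (R : realType).
Local Notation Rm := (measurableTypeR R).
Local Notation lambda := (@lebesgue_measure R).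
Local Open Scope ereal_scope.

(** The derivative of [t ^+ p] for positive [t]; the absolute value keeps it nonnegative on the
    whole line. *)
Definition power_weight (p : nat) (t : R) : R := (p%:R * `|t| ^+ p.-1)%R.

Lemma power_weight_ge0 p t : (0 <= power_weight p t)%R.
Proof. by rewrite /power_weight mulr_ge0// exprn_ge0. Qed.

Lemma measurable_power_weight p : measurable_fun [set: R] (power_weight p).
Proof.
apply: measurable_funM => //; apply: measurable_funX.
exact: normr_measurable.
Qed.

Lemma integral_power_weight p (y : R) : (0 < p)%N -> (0 <= y)%R ->
  \int[lambda]_(t in `]0%R, +oo[ `&` [set t | (t <= y)%R]) (power_weight p t)%:E = (y ^+ p)%:E.
Proof.
move=> p0 y0.
have [->|yn0] := eqVneq y 0%R.
  rewrite expr0n eqn0Ngt p0/= (_ : _ `&` _ = set0) ?integral_set0//.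
  by apply/seteqP; split=> t //=; rewrite in_itv/= andbT => -[t0]; rewrite leNgt t0.
have yp : (0 < y)%R by rewrite lt_def yn0.
rewrite (_ : _ `&` _ = `]0%R, y]%classic); last first.
  apply/seteqP; split=> t /=; rewrite !in_itv/= andbT.
    by move=> [-> ->].
  by move=> /andP[-> ->].
rewrite integral_itv_obnd_cbnd; last first.
  by apply/measurable_EFinP; apply: measurable_funTS; exact: measurable_power_weight.
transitivity (\int[lambda]_(t in `[0%R, y]) (p%:R * t ^+ p.-1)%:E).
  apply: eq_integral => t; rewrite inE/= in_itv/= => /andP[t0 _].
  by rewrite /power_weight ger0_norm.
rewrite (@continuous_FTC2 _ _ (fun t => t ^+ p)%R _ _ yp).
- by rewrite expr0n eqn0Ngt p0/= sube0.
- apply: continuous_in_subspaceT => x _.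
  by apply: cvgM; [exact: cvg_cst|exact: exprn_continuous].
- split.
  + by move=> x _; exact: exprn_derivable.
  + by apply: cvg_at_right_filter; exact: exprn_continuous.
  + by apply: cvg_at_left_filter; exact: exprn_continuous.
- by move=> x _; exact: exp_derive1.
Qed.

(** The test on [t] is explicit because for [l = 0] the power alone would be 1, not 0, from [t = 1]
    on. *)
Definition cone_profile (l : nat) (t : R) : R := if (t < 1)%R then ((1 - t) ^+ l)%R else 0%R.

Lemma measurable_cone_profile l : measurable_fun [set: R] (cone_profile l).
Proof.
apply: measurable_fun_ifT => //.
  exact: measurable_fun_ltr.
apply: measurable_funX; exact: measurable_funB.
Qed.

(** The integral is [p] times the Beta integral [B(p, l + 1)], that is [p! l! / (p + l)!]. All
    binomials of the theorem originate here. *)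
Lemma integral_cone_profile p l : (0 < p)%N ->
  \int[lambda]_(t in `]0%R, +oo[) (power_weight p t * cone_profile l t)%:E =
  (('C(l + p, l))%:R^-1)%:E.
Proof.
move=> p0.
have mX : measurable_fun [set: R] (XMonemX p.-1 l.+1.-1 : R -> R) := measurable_XMonemX _ _.
transitivity (\int[lambda]_(t in `]0%R, 1%R[) (p%:R%:E * (XMonemX p.-1 l t)%:E)).
  rewrite [LHS]integral_mkcond [RHS]integral_mkcond; apply: eq_integral => t _.
  rewrite !patchE; case: ifPn; last first.
    rewrite notin_setE/= in_itv/= andbT => /negP t0.
    by rewrite ifF//; apply/negbTE; rewrite notin_setE/= in_itv/= (negbTE t0).
  rewrite inE/= in_itv/= andbT => t0.
  rewrite /cone_profile; case: ifPn => t1.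
    rewrite ifT; last by rewrite inE/= in_itv/= t0 t1.
    by rewrite -EFinM /power_weight /XMonemX /unstable.onem gtr0_norm// mulrA.
  by rewrite mulr0 ifF//; apply/negbTE; rewrite notin_setE/= in_itv/= t0/= (negbTE t1).
rewrite -(@integral_itv_bndoo _ _ _ _ true false); last first.
  apply: measurable_funTS; apply: measurable_funeM; exact/measurable_EFinP.
rewrite ge0_integralZl//; last 2 first.
- by apply: measurable_funTS; exact/measurable_EFinP.
- by move=> t /= t01; rewrite lee_fin XMonemX_ge0.
have := @EFin_beta_fun R p l.+1.
rewrite beta_funE/= (gtn_eqF p0)/=.
rewrite (_ : \int[_]_x _ = \int[lambda]_(t in `[0%R, 1%R]) (XMonemX p.-1 l t)%:E); last first.
  by rewrite [RHS]integral_mkcond; apply: eq_integral => t _; rewrite !patchE; case: ifP.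
move=> <-; rewrite -EFinM; congr EFin.
case: p p0 {mX} => // p _ /=; rewrite addnS/=.
have hb := bin_fact (leq_addr p.+1 l).
rewrite addKn in hb.
have -> : (('C(l + p.+1, l))%:R = ((l + p.+1)`!)%:R / (l`! * p.+1`!)%:R :> R)%R.
  by rewrite -hb natrM mulfK// pnatr_eq0 -lt0n muln_gt0 !fact_gt0.
have -> : (p + l).+1 = (l + p.+1)%N by rewrite addnS addnC.
rewrite invf_div factS !natrM; ring.
Qed.

End power_integrals.

Section berwald.
Context d (T : measurableType d) (R : realType) (m : {finite_measure set T -> \bar R}).
Local Notation Rm := (measurableTypeR R).
Local Notation lambda := (@lebesgue_measure R).

Let tail (g : T -> R) (t : R) : R := fine (m [set x | t <= g x]).

Let measurable_ge (g : T -> R) t : measurable_fun setT g -> measurable [set x | t <= g x].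
Proof. by move=> mg; exact: measurable_ler_set. Qed.

Let tailE g t : measurable_fun setT g -> (tail g t)%:E = m [set x | t <= g x].
Proof. by move=> mg; rewrite fineK// fin_num_measure//; exact: measurable_ge. Qed.

Let tail_ge0 g t : 0 <= tail g t.
Proof. by apply: fine_ge0; exact: measure_ge0. Qed.

Let measurable_tail g : measurable_fun setT g -> measurable_fun [set: R] (tail g).
Proof.
move=> mg; pose E : set (Rm * T) := [set z | z.1 <= g z.2].
have mE : measurable E by apply: measurable_ler_set => //; exact: measurableT_comp.
have h : measurable_fun [set: Rm] (fun t => m [set x | t <= g x]).
  have := measurable_fun_xsection m mE.
  congr measurable_fun; apply/funext => t /=; congr (m _).
  by apply/seteqP; split=> x; rewrite /xsection/= inE.
by apply: measurableT_comp.
Qed.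

Let integral_pow (g : T -> R) p : (0 < p)%N -> measurable_fun setT g ->
  (forall x, 0 <= g x) ->
  (\int[m]_x (g x ^+ p)%:E =
   \int[lambda]_(t in `]0%R, +oo[) (power_weight p t * tail g t)%:E)%E.
Proof.
move=> p0 mg g0.
transitivity (\int[m]_x \int[lambda]_(t in `]0%R, +oo[ `&` [set t | (t <= g x)%R])
    (power_weight p t)%:E)%E.
  by apply: eq_integral => x _; rewrite integral_power_weight.
rewrite (layer_cake m mg)//.
- by apply: eq_integral => t _; rewrite [RHS]EFinM tailE.
- by apply/measurable_EFinP; exact: measurable_power_weight.
- by move=> t; rewrite lee_fin power_weight_ge0.
Qed.

(* The l-th root of [tail g] is concave, that of [V * cone_profile l] is linear on
   [0, 1] with the same value at 0, so they cross at most once. *)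
Let crossing (l : nat) (V G : R) (g : T -> R) : measurable_fun setT g -> 0 <= V ->
  (forall x, g x <= G) ->
  (forall t s be, 0 < t -> 0 < s <= 1 -> 0 <= be -> (exists x, t <= g x) ->
     be = 0 \/ V * be ^+ l <= tail g t ->
     V * (1 - s + s * be) ^+ l <= tail g (s * t)) ->
  exists2 z, 0 <= z & forall t, 0 < t ->
    (t < z -> V * cone_profile l t <= tail g t) /\
    (z < t -> tail g t <= V * cone_profile l t).
Proof.
move=> mg V0 gG conc.
(* The tail can be strictly below the cone only on [D]; the crossing point is [inf D]. *)
pose D := [set t | 0 < t < 1 /\ tail g t < V * cone_profile l t].
have cone0 t : 0 <= V * cone_profile l t.
  rewrite mulr_ge0// /cone_profile; case: ifP => // t1.
  by rewrite exprn_ge0// subr_ge0 ltW.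
have above t : 0 < t -> ~ D t -> V * cone_profile l t <= tail g t.
  move=> t0 Dt; rewrite leNgt; apply/negP => ht; apply: Dt; split=> //.
  rewrite t0/= ltNge; apply/negP => t1; move: ht.
  have -> : cone_profile l t = 0 by rewrite /cone_profile ltNge t1.
  by rewrite mulr0 ltNge tail_ge0.
have [D0|/set0P/negP/negPn/eqP D0] := pselect (D !=set0); last first.
  (* Without such points the tail stays above the cone, and it vanishes beyond the bound [G] of
     [g]. *)
  exists (Num.max 1 G); first by rewrite le_max ler01.
  move=> t t0; split=> [_|]; first by apply: above => //; rewrite D0.
  rewrite gt_max => /andP[_ Gt]; rewrite /tail (_ : [set x | _] = set0) ?measure0//.
  by apply/seteqP; split=> x //= tg; move: (le_lt_trans (gG x) Gt); rewrite ltNge tg.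
have hi : has_inf D by split=> //; exists 0 => t [/andP[/ltW]].
exists (inf D); first by apply: lb_le_inf => // t [/andP[/ltW]].
move=> t t0; split=> [tD|Dt].
  by apply: above => // Dt; move: tD; rewrite ltNge ge_inf//; case: hi.
have [u [/andP[u0 u1] hu] ut] : exists2 u, D u & u < t.
  move: Dt; rewrite -subr_gt0 => Dt; have [u Du] := inf_adherent Dt hi.
  by rewrite addrC subrK; exists u.
rewrite leNgt; apply/negP => ht.
have ne : exists x, t <= g x.
  apply: contrapT => /forallNP h; move: ht.
  rewrite /tail (_ : [set x | _] = set0) ?measure0 ?ltNge ?cone0//.
  by apply/seteqP; split=> x //= /h.
(* If the tail exceeded the cone at [t], concavity between 0 and [t] would put it above the cone at
   [u], contradicting that [u] lies in [D]. *)
pose s := u / t.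
have s0 : 0 < s by rewrite divr_gt0.
have s1 : s <= 1 by rewrite ler_pdivrMr// mul1r ltW.
have su : s * t = u by rewrite divfK// gt_eqF.
have coneu : cone_profile l u = (1 - u) ^+ l by rewrite /cone_profile u1.
have [t1|t1] := ltP t 1.
  have t1' : 0 <= 1 - t by rewrite subr_ge0 ltW.
  have s01 : 0 < s <= 1 by rewrite s0.
  have h0 : V * (1 - t) ^+ l <= tail g t.
    by move: ht; rewrite /cone_profile t1 => /ltW.
  have := conc t s (1 - t) t0 s01 t1' ne (or_intror h0).
  have -> : 1 - s + s * (1 - t) = 1 - u by rewrite -su; ring.
  by rewrite su -coneu leNgt hu.
(* Beyond the tip of the cone only nonemptiness of the level [t] is used, with end value 0. The case
   [be = 0] is a separate alternative because [0 ^+ l] is 1 when [l = 0]. *)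
have := @conc t s 0 t0; rewrite s0 s1 su => /(_ isT (lexx _) ne (or_introl erefl)).
rewrite mulr0 addr0 => h; move: hu; rewrite ltNge; apply/negP; rewrite negbK.
apply: le_trans h; rewrite coneu; apply: ler_wpM2l => //.
rewrite lerXn2r ?nnegrE ?subr_ge0 ?(ltW u1)//.
by rewrite lerD2l lerN2 ler_pdivrMr// ler_peMr// ltW.
Qed.

(** The normalised case, with a cone of height 1. Tail and cone have equal [q]-th moments and cross
    once, so passing to the larger power [p] gives more weight to the region where the cone
    dominates. *)
Lemma berwald1 (l p q : nat) (V G : R) (g : T -> R) :
  (0 < q <= p)%N -> measurable_fun setT g -> 0 <= V ->
  (forall x, 0 <= g x <= G) ->
  (forall t s be, 0 < t -> 0 < s <= 1 -> 0 <= be -> (exists x, t <= g x) ->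
     be = 0 \/ ((V * be ^+ l)%:E <= m [set x | (t <= g x)%R])%E ->
     ((V * (1 - s + s * be) ^+ l)%:E <= m [set x | (s * t <= g x)%R])%E) ->
  (\int[m]_x (g x ^+ q)%:E = (V / ('C(l + q, l))%:R)%:E)%E ->
  (\int[m]_x (g x ^+ p)%:E <= (V / ('C(l + p, l))%:R)%:E)%E.
Proof.
move=> /andP[q0 qp] mg V0 gG conc gq.
have p0 : (0 < p)%N := leq_trans q0 qp.
have g0 x : 0 <= g x by have /andP[] := gG x.
have [||x|t s be t0 s01 be0 ne h|z z0 hz] := @crossing l V G g => //.
- by have /andP[] := gG x.
- rewrite -lee_fin tailE//; apply: conc => //.
  by case: h => [->|]; [left|rewrite -lee_fin tailE//; right].
have ray (f : R -> R) : measurable_fun setT f ->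
    measurable_fun (`]0%R, +oo[%classic : set Rm) (EFin \o f).
  by move=> mf; apply: measurable_funTS; exact/measurable_EFinP.
have mH r : measurable_fun setT (fun t => power_weight r t * tail g t).
  by apply: measurable_funM; [exact: measurable_power_weight|exact: measurable_tail].
have mH0 r : measurable_fun setT (fun t : R => power_weight r t * cone_profile l t).
  by apply: measurable_funM; [exact: measurable_power_weight|exact: measurable_cone_profile].
have cone0 (t : R) : 0 <= cone_profile l t.
  by rewrite /cone_profile; case: ifP => // t1; rewrite exprn_ge0// subr_ge0 ltW.
pose H r := (\int[lambda]_(t in `]0%R, +oo[) (power_weight r t * tail g t)%:E)%E.
pose H0 r := (\int[lambda]_(t in `]0%R, +oo[) (power_weight r t * cone_profile l t)%:E)%E.
have intZ (c : R) (f : R -> R) : 0 <= c -> measurable_fun setT f -> (forall t, 0 <= f t) ->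
   (\int[lambda]_(t in `]0%R, +oo[) (c * f t)%:E =
    c%:E * \int[lambda]_(t in `]0%R, +oo[) (f t)%:E)%E.
  move=> c0 mf f0; rewrite -ge0_integralZl//.
  - by apply: ray.
  - by move=> t _; rewrite lee_fin.
have intD (f h : R -> R) : measurable_fun setT f -> (forall t, 0 <= f t) ->
  measurable_fun setT h -> (forall t, 0 <= h t) ->
   (\int[lambda]_(t in `]0%R, +oo[) (f t + h t)%:E =
    \int[lambda]_(t in `]0%R, +oo[) (f t)%:E + \int[lambda]_(t in `]0%R, +oo[) (h t)%:E)%E.
  move=> mf f0 mh h0; rewrite -ge0_integralD//.
  - by move=> t _; rewrite lee_fin.
  - exact: ray.
  - by move=> t _; rewrite lee_fin.
  - exact: ray.
have wt r t : 0 <= power_weight r t * tail g t 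
  by apply: mulr_ge0; [exact: power_weight_ge0|exact: tail_ge0].
have wc r (t : R) : 0 <= power_weight r t * cone_profile l t.
  by apply: mulr_ge0; [exact: power_weight_ge0|exact: cone0].
(* The factor [t ^+ (p - q) - C] changes sign at the crossing point together with cone minus tail,
   so their product is nonnegative; [key] is its integral against a multiple of [t ^+ q.-1], with
   all terms moved to positive sides to avoid subtraction in the extended reals. *)
pose C := z ^+ (p - q).
have C0 : 0 <= C by rewrite exprn_ge0.
have key : (q%:R%:E * H p + (C * p%:R * V)%:E * H0 q <=
    (q%:R * V)%:E * H0 p + (C * p%:R)%:E * H q)%E.
  have mZ (c : R) (f : R -> R) : measurable_fun setT f -> measurable_fun setT (fun t => c * f t).
    by move=> mf; exact: measurable_funM.
  have Z0 (c : R) (f : R -> R) : 0 <= c -> (forall t, 0 <= f t) -> forall t, 0 <= c * f t.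
    by move=> c0 f0 t; rewrite mulr_ge0.
  have qR : 0 <= q%:R :> R by [].
  have CpV : 0 <= C * p%:R * V by rewrite !mulr_ge0.
  have qV : 0 <= q%:R * V by rewrite mulr_ge0.
  have Cp : 0 <= C * p%:R by rewrite mulr_ge0.
  rewrite /H /H0 -(intZ _ _ qR (mH p) (wt p)) -(intZ _ _ CpV (mH0 q) (wc q)).
  rewrite -(intZ _ _ qV (mH0 p) (wc p)) -(intZ _ _ Cp (mH q) (wt q)).
  rewrite -(intD _ _ (mZ _ _ (mH p)) (Z0 _ _ qR (wt p)) (mZ _ _ (mH0 q)) (Z0 _ _ CpV (wc q))).
  rewrite -(intD _ _ (mZ _ _ (mH0 p)) (Z0 _ _ qV (wc p)) (mZ _ _ (mH q)) (Z0 _ _ Cp (wt q))).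
  apply: ge0_le_integral => //.
  - by move=> t _; rewrite lee_fin; apply: addr_ge0; apply: mulr_ge0.
  - by apply: ray; apply: measurable_funD; exact: mZ.
  - by apply: ray; apply: measurable_funD; exact: mZ.
  move=> t; rewrite /= in_itv/= andbT lee_fin => t0.
  rewrite /power_weight (gtr0_norm t0).
  have -> : t ^+ p.-1 = t ^+ (p - q) * t ^+ q.-1 by rewrite -exprD -subn1 -subn1 addnBA// subnK.
  have pqt : 0 <= p%:R * q%:R * t ^+ q.-1 by rewrite !mulr_ge0// exprn_ge0// ltW.
  suff : 0 <= (t ^+ (p - q) - C) * (V * cone_profile l t - tail g t).
    move=> /(mulr_ge0 pqt); rewrite -[X in _ -> is_true X]subr_ge0; congr (_ <= _).
    by ring.
  have [lo hi] := hz t t0.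
  have [tz|tz|->] := ltgtP t z.
  - rewrite mulr_le0// subr_le0 ?lo//.
    by rewrite lerXn2r ?nnegrE// ltW.
  - rewrite mulr_ge0// subr_ge0 ?hi//.
    by rewrite lerXn2r ?nnegrE// ltW.
  - by rewrite subrr mul0r.
have CE r : (0 < r)%N -> H0 r = (('C(l + r, l))%:R^-1)%:E by exact: integral_cone_profile.
rewrite integral_pow// -/(H p).
have Hq : H q = (V / ('C(l + q, l))%:R)%:E by rewrite -gq integral_pow.
move: key; rewrite Hq !CE// -!EFinM.
rewrite (_ : C * p%:R * V * _ = C * p%:R * (V / ('C(l + q, l))%:R)); last by ring.
rewrite leeD2rE// -mulrA EFinM.
by rewrite lee_pmul2l// lte_fin ltr0n.
Qed.
End berwald.

Section berwald.
Context d (T : measurableType d) (R : realType) (m : {finite_measure set T -> \bar R}).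

Lemma berwald (l p q : nat) (V G tau : R) (g : T -> R) :
  (0 < q <= p)%N -> measurable_fun setT g -> 0 <= V -> 0 <= tau ->
  (forall x, 0 <= g x <= G) ->
  (forall t s be, 0 < t -> 0 < s <= 1 -> 0 <= be -> (exists x, t <= g x) ->
     be = 0 \/ ((V * be ^+ l)%:E <= m [set x | (t <= g x)%R])%E ->
     ((V * (1 - s + s * be) ^+ l)%:E <= m [set x | (s * t <= g x)%R])%E) ->
  (\int[m]_x (g x ^+ q)%:E = (V * tau ^+ q / ('C(l + q, l))%:R)%:E)%E ->
  (\int[m]_x (g x ^+ p)%:E <= (V * tau ^+ p / ('C(l + p, l))%:R)%:E)%E.
Proof.
move=> qp mg V0 tau0 gG conc gq.
have g0 x : 0 <= g x by have /andP[] := gG x.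
have /andP[q0 qlep] := qp.
have p0 : (0 < p)%N := leq_trans q0 qlep.
have mgX r : measurable_fun setT (fun x => (g x ^+ r)%:E).
  by apply/measurable_EFinP; exact: measurable_funX.
(* A cone of height 0 cannot be rescaled. Here the [q]-th moment is 0, and [g ^+ p] is at most
   [|G| ^+ (p - q)] times [g ^+ q]. *)
have [tau00|taun] := eqVneq tau 0.
  move: gq; rewrite tau00 !expr0n !eqn0Ngt q0 p0/= !mulr0 !mul0r => gq.
  rewrite -(_ : ((`|G| ^+ (p - q))%:E * \int[m]_x (g x ^+ q)%:E)%E = 0%:E); last first.
    by rewrite gq mule0.
  rewrite -ge0_integralZl//; last first.
    by move=> x _; rewrite lee_fin exprn_ge0.
  apply: ge0_le_integral => //.
  - by move=> x _; rewrite lee_fin exprn_ge0.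
  - apply/measurable_EFinP; apply: measurable_funM => //; exact: measurable_funX.
  move=> x _; rewrite lee_fin -[in leLHS](subnK qlep) exprD ler_wpM2r ?exprn_ge0//.
  rewrite lerXn2r ?nnegrE//; have /andP[_ h] := gG x.
  exact: le_trans h (ler_norm _).
have taup : 0 < tau by rewrite lt_def taun.
pose h x := tau^-1 * g x.
have mh : measurable_fun setT h by exact: measurable_funM.
have h_pow r : (\int[m]_x (h x ^+ r)%:E = ((tau ^+ r)^-1)%:E * \int[m]_x (g x ^+ r)%:E)%E.
  rewrite -ge0_integralZl//; last 2 first.
  - by move=> x _; rewrite lee_fin exprn_ge0.
  - by rewrite lee_fin invr_ge0 exprn_ge0.
  by apply: eq_integral => x _; rewrite /h exprMn exprVn.
have hg t x : (t <= h x) = (t * tau <= g x) by rewrite /h mulrC ler_pdivlMr.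
have := @berwald1 d T R m l p q V (tau^-1 * G) h qp mh V0.
have hG x : 0 <= h x <= tau^-1 * G.
  have /andP[g0' gG'] := gG x.
  by rewrite /h mulr_ge0 ?invr_ge0//= ler_wpM2l ?invr_ge0.
move=> /(_ hG).
have hE t : [set x | t <= h x] = [set x | t * tau <= g x].
  by apply/seteqP; split=> x /=; rewrite hg.
have hconc t s be : 0 < t -> 0 < s <= 1 -> 0 <= be -> (exists x, t <= h x) ->
     be = 0 \/ ((V * be ^+ l)%:E <= m [set x | (t <= h x)%R])%E ->
     ((V * (1 - s + s * be) ^+ l)%:E <= m [set x | (s * t <= h x)%R])%E.
  move=> t0 s01 be0 [x hx]; rewrite !hE -mulrA; apply: conc => //.
    by rewrite mulr_gt0.
  by exists x; rewrite -hg.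
move=> /(_ hconc); rewrite !h_pow gq -EFinM.
have -> : (tau ^+ q)^-1 * (V * tau ^+ q / 'C(l + q, l)%:R) = V / 'C(l + q, l)%:R.
  rewrite mulrC -!mulrA; congr (_ * _); rewrite mulrC -mulrA mulVf ?mulr1//.
  by rewrite expf_neq0.
move=> /(_ erefl) hp.
have := lee_wpmul2l (_ : (0 <= (tau ^+ p)%:E)%E) hp.
rewrite lee_fin exprn_ge0// => /(_ isT).
rewrite muleA -!EFinM divff ?mul1e ?expf_neq0//.
by rewrite mulrCA mulrA.
Qed.
End berwald.

(** * Fibers over a coordinate subspace *)

Section fibers.
Context (R : realType) (n : nat).
Local Notation Rm := (measurableTypeR R).
Local Notation T := (n.-tuple (measurableTypeR R)).
Variable mu : 'I_n -> {finite_measure set Rm -> \bar R}.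
Hypothesis hmu : forall k, concave_on_solid (mu k).
Local Notation vol S A := (fine (coord_measure mu S A)).
Local Notation z0 := (zero_tuple R n).

Definition convex_tuples (A : set T) : Prop :=
  forall s x y, 0 <= s <= 1 -> A x -> A y -> A (comb s x y).

Variables (sigma : {set 'I_n}) (A : set T).
Hypotheses (mA : measurable A) (sA : solid A) (cA : convex_tuples A) (A0 : A z0).

Definition fiber (x : T) : set T := [set y | A (merge (~: sigma)%SET x y)].
(** By solidity a fiber is nonempty exactly when it contains 0, so this section is the projection
    along [sigma], with the coordinates in [sigma] left free. *)
Definition base : set T := [set x | fiber x z0].
Definition fiber_vol (tau : {set 'I_n}) (x : T) : R := vol tau (fiber x).

Lemma vol_ge0 S X : 0 <= vol S X.
Proof. by apply: fine_ge0; exact: measure_ge0. Qed.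

Lemma vol_le S X Y : measurable X -> measurable Y -> X `<=` Y -> vol S X <= vol S Y.
Proof.
move=> mX mY XY; rewrite -lee_fin -!coord_measure_finE//.
by apply: le_measure; rewrite ?inE.
Qed.

Lemma merge_zero S : merge S z0 z0 = z0.
Proof. by apply: eq_from_tnth => k; rewrite !tnth_mktuple if_same. Qed.

Lemma measurable_fiber x : measurable (fiber x).
Proof.
have := measurableT_comp (measurable_merge (~: sigma)%SET) (pair1_measurable x).
by move=> /(_ measurableT _ mA); rewrite setTI.
Qed.

Lemma solid_fiber x : solid (fiber x).
Proof.
move=> y z Az yz; apply: sA Az _ => k; rewrite !tnth_mktuple.
by case: ifP.
Qed.

Lemma fiber_dec x y : (forall k, `|tnth x k : R| <= `|tnth y k : R|) ->
  fiber y `<=` fiber x.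
Proof.
move=> xy z Az; apply: sA Az _ => k; rewrite !tnth_mktuple.
by case: ifP.
Qed.

Lemma fiber_comb s x y u v : 0 <= s <= 1 -> fiber x u -> fiber y v ->
  fiber (comb s x y) (comb s u v).
Proof.
move=> s01 xu yv; rewrite /fiber /=.
have -> : merge (~: sigma)%SET (comb s x y) (comb s u v) =
  comb s (merge (~: sigma)%SET x u) (merge (~: sigma)%SET y v).
  by apply: eq_from_tnth => k; rewrite !tnth_mktuple; case: ifP.
exact: cA.
Qed.

Lemma fiber_out x : ~ base x -> fiber x = set0.
Proof.
move=> Lx; apply/seteqP; split=> y // xy; apply: Lx.
exact: solid_zero (@solid_fiber x) xy.
Qed.

Lemma measurable_base : measurable base.
Proof.
have := measurableT_comp (measurable_merge (~: sigma)%SET) (pair2_measurable z0).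
by move=> /(_ measurableT _ mA); rewrite setTI.
Qed.

Lemma solid_base : solid base.
Proof. by move=> x y Ly xy; exact: fiber_dec xy _ Ly. Qed.

Lemma base_zero : base z0.
Proof. by rewrite /base /fiber /= merge_zero. Qed.

Lemma coord_measure_baseE :
  coord_measure mu (~: sigma)%SET base = coord_measure mu (~: sigma)%SET A.
Proof.
apply: coord_measure_supp => x x0; rewrite /base /fiber /=.
suff -> : merge (~: sigma)%SET x z0 = x by [].
apply: eq_from_tnth => k; rewrite !tnth_mktuple; case: ifPn => // ks.
by rewrite x0.
Qed.

Lemma fiber_vol_out tau x : ~ base x -> fiber_vol tau x = 0.
Proof. by move=> /fiber_out; rewrite /fiber_vol => ->; rewrite measure0. Qed.

Lemma measurable_fiber_vol tau : measurable_fun setT (fiber_vol tau).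
Proof.
pose E := (fun p => merge (~: sigma)%SET p.1 p.2) @^-1` A.
have mE : measurable E by rewrite -[X in measurable X]setTI; exact: measurable_merge.
have h : measurable_fun [set: T] (fun x => coord_measure mu tau (fiber x)).
  have := measurable_fun_xsection (coord_measure mu tau) mE.
  congr measurable_fun; apply/funext => t /=; congr (coord_measure mu tau _).
  by apply/seteqP; split=> y; rewrite /xsection/= inE.
by apply: measurableT_comp.
Qed.

Lemma integral_fiber_vol (tau : {set 'I_n}) : tau \subset sigma ->
  (\int[coord_measure mu (~: sigma)%SET]_x (fiber_vol tau x)%:E)%E =
  (vol (~: sigma :|: tau)%SET A)%:E.
Proof.
move=> ts; rewrite -coord_measure_finE// coord_measure_merge//; last first.
  move=> k; rewrite inE; apply: contra; exact: (fintype.subsetP ts).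
by apply: eq_integral => x _; rewrite -coord_measure_finE//; exact: measurable_fiber.
Qed.

(* Concavity of [fiber_vol tau] to the power 1/#|tau|; only the case where one end
   of the segment contributes 0 is needed. *)
Lemma fiber_vol_concave (tau : {set 'I_n}) s x y t : 0 <= s <= 1 -> 0 <= t -> base x -> base y ->
  t ^+ #|tau| <= fiber_vol tau y -> (0 < #|tau|)%N ->
  (s * t) ^+ #|tau| <= fiber_vol tau (comb s x y).
Proof.
move=> s01 t0 Lx Ly hy tau0; rewrite -lee_fin -coord_measure_finE; last exact: measurable_fiber.
have := @brunn_minkowski R n mu hmu tau s 0 t (fiber x) (fiber y) (fiber (comb s x y))
  s01 (lexx _) t0.
rewrite mulr0 add0r; apply=> //; try exact: measurable_fiber; try exact: solid_fiber.
- by move=> u v xu yv; exact: fiber_comb.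
- rewrite expr0n eqn0Ngt tau0/=; exact: measure_ge0.
- by rewrite coord_measure_finE ?lee_fin//; exact: measurable_fiber.
Qed.

(** Since [g] is the [#|tau|]-th root of a fiber volume, [(1 - s) base + s {g >= t}] lies in
    [{g >= s t}]; Brunn-Minkowski on the base then bounds the tail along the segment from 0 to
    [t]. *)
Lemma level_concave (tau : {set 'I_n}) (g : T -> R) t s be :
  (0 < #|tau|)%N -> measurable_fun setT g -> (forall x, 0 <= g x) ->
  (forall x, g x ^+ #|tau| = fiber_vol tau x) ->
  0 < t -> 0 < s <= 1 -> 0 <= be -> (exists x, t <= g x) ->
  be = 0 \/ ((vol (~: sigma)%SET A * be ^+ #|~: sigma|%SET)%:E <=
     coord_measure mu (~: sigma)%SET [set x | (t <= g x)%R])%E ->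
  ((vol (~: sigma)%SET A * (1 - s + s * be) ^+ #|~: sigma|%SET)%:E <=
     coord_measure mu (~: sigma)%SET [set x | (s * t <= g x)%R])%E.
Proof.
move=> tau0 mg g0 gE t0 /andP[s0 s1] be0 [x0 tx0] hbe.
set l := #|~: sigma|%SET; set S := (~: sigma)%SET.
have s01 : 0 <= s <= 1 by rewrite ltW.
have le_pow u x : 0 <= u -> (u <= g x) = (u ^+ #|tau| <= fiber_vol tau x).
  by move=> u0; rewrite -gE ler_pXn2r ?nnegrE.
have level_base u x : 0 < u -> u <= g x -> base x.
  move=> u0; rewrite le_pow; last exact: ltW. move=> ux; apply: contrapT => /(fiber_vol_out tau) f0.
  by move: ux; rewrite f0 leNgt exprn_gt0.
have glevel x y : (forall k, `|tnth x k : R| <= `|tnth y k : R|) -> g y <= g x.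
  move=> xy; rewrite le_pow ?gE//; apply: vol_le; try exact: measurable_fiber.
  exact: fiber_dec.
have solid_level u : solid [set x | u <= g x].
  by move=> x y uy xy; exact: le_trans uy (glevel _ _ xy).
have level0 u : u <= t -> u <= g z0.
  move=> ut; apply: (le_trans ut); apply: (le_trans tx0); apply: glevel => k.
  by rewrite tnth_mktuple normr0.
(* For [l = 0] no root can be taken, but the base then has volume 1 because it contains 0. *)
have [al al0 alE] : exists2 al, 0 <= al & al ^+ l = vol S A.
  have [l0|l0] := posnP l; last by apply: nneg_root => //; exact: vol_ge0.
  exists 1 => //; rewrite expr1n /S; have -> : (~: sigma)%SET = finset.set0 by exact: cards0_eq.
  by rewrite coord_measure_set0 indicE mem_set.
have := @brunn_minkowski R n mu hmu S s al (al * be) base [set x | t <= g x]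
  [set x | s * t <= g x] s01 al0 (mulr_ge0 al0 be0).
rewrite -/l -alE -exprMn (_ : al * (1 - s + s * be) = (1 - s) * al + s * (al * be)); last by ring.
apply=> //.
- exact: measurable_base.
- exact: measurable_ler_set.
- exact: measurable_ler_set.
- exact: solid_base.
- exact: base_zero.
- exact: level0.
- move=> x y Lx ty /=; rewrite le_pow; last by rewrite mulr_ge0// ltW.
  apply: fiber_vol_concave => //; first exact: ltW.
    exact: level_base ty.
  by rewrite -le_pow// ltW.
- by rewrite alE coord_measure_baseE -coord_measure_finE.
- case: hbe => [->|]; last by rewrite -/l -/S -alE -exprMn.
  rewrite mulr0 expr0n; have [l0|l0] := posnP l.
    rewrite /S; have -> : (~: sigma)%SET = finset.set0 by exact: cards0_eq.
    by rewrite coord_measure_set0 indicE mem_set//=; exact: level0.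
  exact: measure_ge0.
Qed.

End fibers.

(** * Counting incidences of a cover *)

(** The pairs [(i, j)] with [j < a i] encode a family in which index [i] is repeated [a i] times, as
    [hoelder_prod] requires. *)
Lemma prod_pairs (R : comNzRingType) (m d : nat) (a : 'I_m -> nat) (h : 'I_m -> R) :
  (forall i, (a i <= d)%N) ->
  \prod_(p in [pred p : 'I_m * 'I_d | (p.2 < a p.1)%N]) h p.1 = \prod_i h i ^+ a i.
Proof.
move=> ad; rewrite -(pair_big_dep xpredT (fun i (j : 'I_d) => (j < a i)%N) (fun i _ => h i))/=.
apply: eq_bigr => i _.
by rewrite -(big_ord_widen d (fun=> h i) (ad i)) prodr_const card_ord.
Qed.

Lemma card_pairs (m d : nat) (a : 'I_m -> nat) : (forall i, (a i <= d)%N) ->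
  #|[pred p : 'I_m * 'I_d | (p.2 < a p.1)%N]| = (\sum_i a i)%N.
Proof.
move=> ad; rewrite -sum1_card.
rewrite -(pair_big_dep xpredT (fun i (j : 'I_d) => (j < a i)%N) (fun _ _ => 1%N))/=.
apply: eq_bigr => i _.
by rewrite -(big_ord_widen d (fun=> 1%N) (ad i)) sum1_card card_ord.
Qed.

Lemma sum_card_cover (n m k : nat) (sigma : {set 'I_n}) (tau : 'I_m -> {set 'I_n}) :
  (forall i, tau i \subset sigma) ->
  (forall j, j \in sigma -> #|[set i | j \in tau i]| = k) ->
  (\sum_i #|tau i| = k * #|sigma|)%N.
Proof.
move=> ts cover.
under eq_bigr => i _.
  rewrite -sum1_card (bigID (mem sigma))/= [X in (_ + X)%N]big1 ?addn0; last first.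
    by move=> j /andP[/(fintype.subsetP (ts i)) ->].
  under eq_bigl do rewrite andbC.
  rewrite big_mkcondr/=.
  over.
rewrite exchange_big/= -sum1_card big_distrr/=; apply: eq_bigr => j js.
rewrite muln1 -(cover j js) (card_classical_set (fun i => j \in tau i)).
by rewrite -big_mkcond/= sum1_card.
Qed.

(** * The inequality for solid convex sets of tuples *)

Section core.
Context (R : realType) (n : nat).
Local Notation Rm := (measurableTypeR R).
Local Notation T := (n.-tuple (measurableTypeR R)).
Variable mu : 'I_n -> {finite_measure set Rm -> \bar R}.
Hypothesis hmu : forall k, concave_on_solid (mu k).
Local Notation vol S A := (fine (coord_measure mu S A)).
Local Notation z0 := (zero_tuple R n).

(** The theorem for [tau i = sigma \ sigma_i] and [k = m - lambda], before cancelling the common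
    power [V ^+ k]. *)
Lemma local_loomis_whitney (sigma : {set 'I_n}) (A : set T) (m k : nat)
    (tau : 'I_m -> {set 'I_n}) :
  measurable A -> solid A -> convex_tuples A -> A z0 ->
  (0 < k)%N -> (0 < #|sigma|)%N ->
  (forall i, tau i \subset sigma) ->
  (forall j, j \in sigma -> #|[set i | j \in tau i]| = k) ->
  vol (~: sigma)%SET A ^+ m * vol [set: 'I_n]%SET A ^+ k <=
  (vol (~: sigma)%SET A / 'C(n, n - #|sigma|)%:R) ^+ k *
  \prod_(i < m) ('C(n - #|sigma| + #|tau i|, n - #|sigma|)%:R * vol (~: sigma :|: tau i)%SET A).
Proof.
move=> mA sA cA A0 k0 d0 ts cover.
set S := (~: sigma)%SET; set V := vol S A; set d := #|sigma|; set l := (n - d)%N.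
have V0 : 0 <= V by exact: vol_ge0.
have lE : #|S| = l by rewrite cardsCs finset.setCK card_ord.
have ld : (l + d = n)%N.
  by rewrite subnK// -[leqRHS]card_ord; exact: max_card.
have cover0 j : j \in sigma -> (0 < m)%N.
  move=> js; have := cover j js; case: m tau ts cover => // tau _ _ h.
  have : (#|[set i | j \in tau i]| <= #|'I_0|)%N by exact: max_card.
  by rewrite card_ord h leqNgt k0.
have [j js] : exists j, j \in sigma by apply/card_gt0P.
have m0 := cover0 j js.
have [V00|Vn0] := eqVneq V 0.
  by rewrite V00 mul0r !expr0n !eqn0Ngt m0 k0 !mul0r.
have Vp : 0 < V by rewrite lt_def Vn0.
pose f i x := fiber_vol mu sigma A (tau i) x.
pose a i := #|tau i|.
have ad i : (a i <= d)%N by exact: subset_leq_card.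
pose Q i := vol (S :|: tau i)%SET A.
have Q0 i : 0 <= Q i by exact: vol_ge0.
have QE i : (\int[coord_measure mu S]_x (f i x)%:E)%E = (Q i)%:E.
  by rewrite integral_fiber_vol.
have f0 i x : 0 <= f i x by exact: vol_ge0.
have mf i : measurable_fun setT (f i) by exact: measurable_fiber_vol.
(* For [a i = 0] the exponent is [0^-1 = 0], so [g i] is the constant 1; its moments are finite and
   it enters Hoelder with multiplicity 0. *)
pose g i x := f i x `^ (a i)%:R^-1.
have g0 i x : 0 <= g i x by exact: powR_ge0.
have mg i : measurable_fun setT (g i).
  exact: (measurableT_comp (measurable_powR (a i)%:R^-1) (mf i)).
have ga i x : (0 < a i)%N -> g i x ^+ a i = f i x.
  move=> ai; rewrite /g -powR_mulrn ?powR_ge0// -powRrM mulVf ?powRr1//.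
  by rewrite pnatr_eq0 -lt0n.
pose G i := vol (tau i) setT `^ (a i)%:R^-1.
have gG i x : g i x <= G i.
  apply: ge0_ler_powR; rewrite ?nnegrE ?invr_ge0//; first exact: vol_ge0.
  apply: vol_le => //; exact: measurable_fiber.
pose J i := fine (\int[coord_measure mu S]_x (g i x ^+ d)%:E).
have JE i : (\int[coord_measure mu S]_x (g i x ^+ d)%:E)%E = (J i)%:E.
  rewrite fineK// ge0_fin_numE; last first.
    by apply: integral_ge0 => x _; rewrite lee_fin exprn_ge0.
  apply: (@le_lt_trans _ _ (\int[coord_measure mu S]_x cst ((G i ^+ d)%:E) x)%E).
    apply: ge0_le_integral => //.
    - by move=> x _; rewrite lee_fin exprn_ge0.
    - by apply/measurable_EFinP; exact: measurable_funX.
    - by move=> x _; rewrite lee_fin lerXn2r ?nnegrE ?powR_ge0.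
  rewrite integral_cst// -ge0_fin_numE ?mule_ge0 ?lee_fin ?exprn_ge0 ?powR_ge0//.
  by rewrite fin_numM// fin_num_measure.
have J0 i : 0 <= J i.
  by rewrite -lee_fin -JE; apply: integral_ge0 => x _; rewrite lee_fin exprn_ge0.
have C0 p : 0 < ('C(l + p, l))%:R :> R by rewrite ltr0n bin_gt0 leq_addr.
(* [t i] is the height of the cone over volume [V] with the [a i]-th moment [Q i]. For [a i = 0] the
   requirement reads [V = Q i], and any height works. *)
have [t tP] : exists t : 'I_m -> R, forall i,
    0 <= t i /\ V * t i ^+ a i = ('C(l + a i, l))%:R * Q i.
  suff h i : exists r : R, 0 <= r /\ V * r ^+ a i = ('C(l + a i, l))%:R * Q i.
    by exists (fun i => projT1 (cid (h i))) => i; exact: projT2 (cid (h i)).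
  have [ai|ai] := posnP (a i).
    exists 1; split=> //; rewrite ai addn0 binn expr0 mul1r mulr1.
    rewrite /Q; have -> : tau i = finset.set0 by exact: cards0_eq.
    by rewrite finset.setU0.
  have [r r0 rE] := nneg_root ai
    (divr_ge0 (mulr_ge0 (ltW (C0 (a i))) (Q0 i)) V0).
  by exists r; split=> //; rewrite rE mulrC divfK.
have t0 i : 0 <= t i by have [] := tP i.
have tE i : V * t i ^+ a i = ('C(l + a i, l))%:R * Q i by have [] := tP i.
have berw i : (0 < a i)%N -> J i <= V / ('C(l + d, l))%:R * t i ^+ d.
  move=> ai; rewrite -lee_fin -JE mulrAC.
  apply: (@berwald _ _ _ (coord_measure mu S) l d (a i) V (G i) (t i) (g i)) => //.
  - by rewrite ai ad.
  - by move=> x; rewrite g0 gG.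
  - move=> r s be r0 s01 be0 ne hbe; rewrite -lE.
    apply: (@level_concave R n mu hmu sigma A mA sA cA A0 (tau i) (g i)) => //.
      by move=> x; exact: ga.
    by rewrite lE.
  - rewrite tE mulrC mulKf ?gt_eqF// -QE; apply: eq_integral => x _.
    by rewrite ga.
(* Hoelder for the [k * d] functions bounds the volume to the power [k * d] by the product of the
   [J i ^+ a i]; with [berw] this leaves the [k]-th root [om] of the product of the [t i ^+ a i]. *)
have [om om0 omE] := nneg_root k0
  (@prodr_ge0 R _ (index_enum 'I_m) xpredT (fun i => t i ^+ a i) (fun i _ => exprn_ge0 _ (t0 i))).
have VT : vol [set: 'I_n]%SET A <= V / ('C(l + d, l))%:R * om.
  rewrite -lee_fin (_ : [set: 'I_n]%SET = (~: sigma :|: sigma)%SET); last first.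
    by rewrite finset.setUC finset.setUCr.
  rewrite -integral_fiber_vol//.
  pose I := [pred p : 'I_m * 'I_d | (p.2 < a p.1)%N].
  have cI : #|I| = (k * d)%N by rewrite card_pairs// (sum_card_cover ts cover).
  apply: (@hoelder_prod _ _ _ (coord_measure mu S) _ I 1 _ _
    (fun p x => g p.1 x ^+ d) (fun p => J p.1)) => //.
  - by rewrite cI muln_gt0 k0.
  - by rewrite mulr_ge0// divr_ge0.
  - exact: measurable_fiber_vol.
  - by move=> p; exact: measurable_funX.
  - by move=> x; exact: vol_ge0.
  - by move=> p x; rewrite exprn_ge0.
  - move=> x; rewrite cI mul1r (prod_pairs (fun i => g i x ^+ d) ad).
    under eq_bigr do rewrite exprAC.
    rewrite prodrXl exprM; apply: lerXn2r; rewrite ?nnegrE.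
    + by rewrite exprn_ge0// vol_ge0.
    + by apply: prodr_ge0 => i _; rewrite exprn_ge0.
    have [Lx|Lx] := pselect (base sigma A x); last first.
      rewrite fiber_vol_out// expr0n eqn0Ngt k0/=.
      by apply: prodr_ge0 => i _; rewrite exprn_ge0.
    apply: (@le_trans _ _ (\prod_i f i x)).
      have := @loomis_whitney R n mu m k tau sigma (fiber sigma A x) k0
        (measurable_fiber sigma mA x) (@solid_fiber _ _ sigma A sA x) Lx cover.
      move=> /le_trans; apply; rewrite le_eqVlt; apply/orP; left; apply/eqP.
      by apply: eq_bigr => i _; rewrite (finset.setIidPl (ts i)).
    apply: ler_prod => i _; rewrite f0/=.
    (* For empty [tau i] the fiber volume is a Dirac mass, hence at most 1. *)
    have [ai|ai] := posnP (a i); last by rewrite ga.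
    rewrite ai expr0 /f /fiber_vol.
    have -> : tau i = finset.set0 by exact: cards0_eq.
    by rewrite coord_measure_set0/= indicE; case: (_ \in _).
  - rewrite cI mul1r (prod_pairs J ad).
    rewrite exprMn [om ^+ _]exprM omE -prodrXl.
    rewrite -{1}(sum_card_cover ts cover) expr_sum -big_split/=.
    apply: ler_prod => i _; rewrite exprn_ge0//= -/(a i).
    have [ai|ai] := posnP (a i); first by rewrite ai !expr0 expr1n mulr1.
    by rewrite exprAC -exprMn lerXn2r ?nnegrE ?berw// mulr_ge0 ?exprn_ge0// divr_ge0.
have Vm : V ^+ m * om ^+ k = \prod_(i < m) (('C(l + a i, l))%:R * Q i).
  rewrite omE -[in V ^+ m](card_ord m) -prodr_const -big_split/=.
  by apply: eq_bigr => i _; exact: tE.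
rewrite ld in VT.
rewrite -[\prod_(i < m) _]/(\prod_(i < m) (('C(l + a i, l))%:R * Q i)) -Vm.
rewrite mulrCA ler_wpM2l ?exprn_ge0// -exprMn lerXn2r ?nnegrE//.
- exact: vol_ge0.
- by rewrite mulr_ge0// divr_ge0.
Qed.
End core.

(** * Unconditional convex bodies *)

Section bodies.
Context (R : realType) (n : nat).
Local Notation Rm := (measurableTypeR R).
Local Notation T := (n.-tuple (measurableTypeR R)).
Variable K : set 'rV[R]_n.

Lemma compact_row_bound : compact K ->
  exists2 M : R, 0 <= M & forall x i, K x -> `|x 0 i| <= M.
Proof.
move=> /compact_bounded [M [_ hM]].
exists (`|M| + 1) => [|x i Kx]; first by rewrite addr_ge0.
have h : `|x| <= `|M| + 1.
  by apply: hM => //; rewrite (le_lt_trans (ler_norm M))// ltrDl.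
apply: le_trans h; rewrite {2}/Num.norm/= mx_normrE.
exact: (le_bigmax _ (fun ij : 'I_1 * 'I_n => `|x ij.1 ij.2|) (0, i)).
Qed.

(** The complement is open, hence a countable union of open cubes with rational centre and radius
    [1/(k+1)]; [pickle] enumerates the cubes. *)
Lemma measurable_row_compact : compact K -> measurable (@row_of R n @^-1` K).
Proof.
move=> cK.
have clK : closed K by apply: compact_closed => //; exact: norm_hausdorff.
pose B (q : n.-tuple rat * nat) : set T :=
  box (fun i => [set` `](ratr (tnth q.1 i) - q.2.+1%:R^-1), (ratr (tnth q.1 i) + q.2.+1%:R^-1)[%R]).
pose F m : set T := if unpickle m is Some q then
  (if `[< B q `<=` ~` (@row_of R n @^-1` K) >] then B q else set0) else set0.
rewrite -[X in measurable X]setCK; apply: measurableC.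
rewrite (_ : ~` _ = \bigcup_m F m).
  apply: bigcup_measurable => m _; rewrite /F; case: unpickle => // q.
  case: asboolP => // _; apply: measurable_box => i; exact: measurable_itv.
apply/seteqP; split=> [t Kt|t [m _]]; last first.
  by rewrite /F; case: unpickle => // q; case: asboolP => // h /h.
have : nbhs (row_of t) (~` K).
  by apply: open_nbhs_nbhs; split=> //; exact: closed_openC.
move=> /nbhs_ballP[e /= e0 he].
have [k ke] : exists k : nat, k.+1%:R^-1 + k.+1%:R^-1 < e.
  have e2 : 0 < e / 2 by rewrite divr_gt0.
  have [k _ hk] := near_infty_natSinv_lt (PosNum e2).
  by exists k; have /= h := hk k (leqnn k); rewrite [ltRHS](splitr e) ltrD.
have k0 : (0 : R) < k.+1%:R^-1 by rewrite invr_gt0.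
have [q hq] : exists q : n.-tuple rat, forall i, `|(ratr (tnth q i) : R) - tnth t i| < k.+1%:R^-1.
  suff h i : exists r : rat, `|(ratr r : R) - tnth t i| < k.+1%:R^-1.
    exists [tuple projT1 (cid (h i)) | i < n] => i; rewrite tnth_mktuple.
    exact: projT2 (cid (h i)).
  have [r] := @rat_in_itvoo R (tnth t i) (tnth t i + k.+1%:R^-1) (ltr_pwDr k0 (lexx _)).
  rewrite in_itv/= => /andP[r1 r2]; exists r.
  by rewrite gtr0_norm ?subr_gt0// ltrBlDl.
have Bt : B (q, k) t.
  by move=> i; rewrite /= in_itv/= -ltr_distlC.
exists (pickle (q, k)) => //; rewrite /F pickleK ifT//.
apply/asboolP => u Bu; apply: he; split=> // a i; rewrite ord1 !mxE.
rewrite -ball_normE/=; apply: lt_trans ke.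
have := Bu i; rewrite /= in_itv/= -ltr_distlC => hu.
rewrite -(subrKA (ratr (tnth q i))); apply: (le_lt_trans (ler_normD _ _)).
apply: ltrD => //.
by rewrite distrC hq.
Qed.

Hypotheses (cK : convex_set K) (uK : unconditional K).

Lemma row_comb s x y : row_of (comb s x y) = (1 - s) *: row_of x + s *: row_of y :> 'rV[R]_n.
Proof. by apply/rowP => i; rewrite !mxE tnth_mktuple. Qed.

Lemma convex_tuples_row : convex_tuples (@row_of R n @^-1` K).
Proof.
move=> s x y /andP[s0 s1] Kx Ky; rewrite /preimage /= row_comb.
have := cK (Itv01 s0 s1) (mem_set Ky) (mem_set Kx).
by rewrite inE /conv/= addrC.
Qed.

(** Coordinates are shrunk one at a time: a point and its mirror image in coordinate [j] both lie in
    [K], and so does the segment between them. *)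
Lemma solid_row : solid (@row_of R n @^-1` K).
Proof.
pose flip (j : 'I_n) (y : T) := upd j (- tnth y j) y.
have flipK j y : K (row_of y) -> K (row_of (flip j y)).
  move=> Ky; rewrite -(@uK (fun i => if i == j then -1 else 1)); last first.
    by move=> i; case: ifP => _; [right|left].
  exists (row_of y) => //; apply/rowP => i; rewrite !mxE tnth_mktuple.
  by case: eqP => [->|_]; rewrite ?mulN1r ?mul1r.
have step j (c : R) y : K (row_of y) -> `|c| <= `|tnth y j : R| -> K (row_of (upd j c y)).
  move=> Ky cy; have [y0|y0] := eqVneq (tnth y j : R) 0.
    by move: cy; rewrite y0 normr0 normr_le0 => /eqP ->; rewrite upd_id.
  (* The solution of [(1 - s) y_j - s y_j = c]. *)
  pose s := (1 - c / tnth y j) / 2.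
  have cy1 : `|c / tnth y j| <= 1.
    by rewrite normf_div ler_pdivrMr ?normr_gt0// mul1r.
  have s01 : 0 <= s <= 1.
    move: cy1; rewrite ler_norml => /andP[h1 h2]; rewrite /s; apply/andP; split; lra.
  have := convex_tuples_row s01 Ky (flipK j y Ky).
  rewrite /preimage/=; congr (K (row_of _)); apply: eq_from_tnth => k.
  rewrite !tnth_mktuple; case: eqP => [->|_]; last by ring.
  by rewrite /s; field.
move=> x y Ky xy.
(* The first [m] coordinates have already been replaced. *)
pose z m : T := [tuple if (i < m)%N then tnth x i else tnth y i | i < n].
suff h m : (m <= n)%N -> K (row_of (z m)).
  rewrite /preimage /= (_ : x = z n); first exact: h.
  by apply: eq_from_tnth => i; rewrite tnth_mktuple ltn_ord.
elim: m => [_|m IH mn].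
  by rewrite (_ : z 0%N = y)//; apply: eq_from_tnth => i; rewrite tnth_mktuple.
have := step (Ordinal mn) (tnth x (Ordinal mn)) (z m) (IH (ltnW mn)).
rewrite tnth_mktuple /= ltnn => /(_ (xy _)).
congr (K (row_of _)); apply: eq_from_tnth => i; rewrite !tnth_mktuple.
rewrite [in RHS]ltnS [in RHS]leq_eqVlt -val_eqE /=; case: eqP => //= e.
by congr tnth; exact/val_inj.
Qed.

Lemma span_basis_out (tau : {set 'I_n}) (v : 'rV[R]_n) k :
  (v <= Defs.span_basis tau)%MS -> k \notin tau -> v 0 k = 0.
Proof.
move=> vs kt.
(* The span lies in the kernel of the [k]-th coordinate form. *)
have /(submx_trans vs) : (Defs.span_basis tau <= kermx (delta_mx k 0 : 'cV[R]_n))%MS.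
  apply/sumsmx_subP => i it; rewrite genmxE; apply/sub_kermxP.
  rewrite mul_delta_mx_cond (_ : (i == k) = false) ?mulr0n//.
  by apply/negbTE; apply: contraNneq kt => <-.
move=> /sub_kermxP /matrixP /(_ 0 0); rewrite !mxE (bigD1 k)//= big1 ?addr0.
  by rewrite mxE !eqxx mulr1.
by move=> i ik; rewrite mxE (negbTE ik) mulr0.
Qed.

(** Projecting kills the coordinates in [tau], which keeps a point in [K] by solidity; conversely a
    point of [K] in the subspace is its own projection. *)
Lemma ortho_proj_section (tau : {set 'I_n}) :
  @coord_embed R n (~: tau)%SET @^-1` ortho_proj (ortho_span tau) K =
  @coord_embed R n (~: tau)%SET @^-1` K.
Proof.
apply/seteqP; split=> t; rewrite /preimage /=; set y : 'rV[R]_n := coord_embed t.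
  have y0 k : k \in tau -> y 0 k = 0.
    by move=> kt; rewrite /y coord_embed_out// inE negbK.
  move=> [x Kx [_ hz]].
  have yx k : k \notin tau -> y 0 k = x 0 k.
    (* For [k] outside [tau] the vector [e_k] lies in the subspace, so orthogonality to it
       identifies the [k]-th coordinates. *)
    move=> kt; have := hz (delta_mx 0 k).
    rewrite /dotv (bigD1 k)//= big1 ?addr0; last first.
      by move=> i ik; rewrite !mxE (negbTE ik) andbF mulr0.
    rewrite !mxE !eqxx mulr1 => h; apply/eqP; rewrite eq_sym -subr_eq0 h//.
    move=> v vs; rewrite /dotv (bigD1 k)//= big1 ?addr0.
      by rewrite (span_basis_out vs kt) mulr0.
    by move=> i ik; rewrite !mxE (negbTE ik) andbF mul0r.
  have toK (w : 'rV[R]_n) : row_of [tuple w 0 i | i < n] = w.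
    by apply/rowP => i; rewrite mxE tnth_mktuple.
  rewrite -(toK y); apply: (@solid_row _ [tuple x 0 i | i < n]).
    by rewrite /preimage /= toK.
  move=> k; rewrite !tnth_mktuple; have [kt|kt] := boolP (k \in tau).
    by rewrite y0// normr0.
  by rewrite yx.
move=> Ky; exists y => //; split.
  move=> v vs; rewrite /dotv big1// => k _; have [kt|kt] := boolP (k \in tau).
    by rewrite /y coord_embed_out ?mul0r// inE negbK.
  by rewrite (span_basis_out vs kt) mulr0.
by move=> z _; rewrite subrr /dotv big1// => k _; rewrite mxE mul0r.
Qed.

End bodies.

(** * Restriction of the measures to a bounded interval *)

Section restriction.
Context (R : realType).
Local Notation Rm := (measurableTypeR R).

Lemma integral_restr (m m' : {measure set Rm -> \bar R}) (I : set Rm) (f : Rm -> \bar R) :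
  (forall U, measurable U -> U `<=` I -> m' U = m U) ->
  (forall x, ~ I x -> f x = 0%E) -> (\int[m]_x f x = \int[m']_x f x)%E.
Proof.
move=> mm' f0; have -> : f = f \_ I.
  by apply/funext => x; rewrite patchE; case: ifPn => //; rewrite notin_setE => /f0.
rewrite -!integral_mkcond; apply: eq_measure_integral => U mU UI.
by rewrite mm'.
Qed.

(** A set of tuples with entries in [I] sees the factors only on [I], so possibly infinite measures
    can be exchanged for finite ones. In the recursion, sections over points outside [I] are
    empty. *)
Lemma prod_measure_restr (I : set Rm) n
    (mu : 'I_n -> {measure set Rm -> \bar R})
    (mu' : 'I_n -> {finite_measure set Rm -> \bar R}) (B : set (n.-tuple Rm)) :
  (forall k U, measurable U -> U `<=` I -> mu' k U = mu k U) ->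
  measurable B -> (forall t i, B t -> I (tnth t i)) ->
  prod_measure mu B = prod_measure mu' B.
Proof.
elim: n mu mu' B => [//|n IH] mu mu' B mm' mB BI /=.
rewrite /pushforward /product_measure1.
have mB' : measurable (@cons_pair Rm n @^-1` B).
  by rewrite -[X in measurable X]setTI; exact: measurable_cons_pair.
transitivity (\int[mu ord0]_x prod_measure (fun i => mu' (lift ord0 i))
    (xsection (@cons_pair Rm n @^-1` B) x))%E.
  apply: eq_integral => x _ /=; apply: IH => [k U mU UI||t i].
  - exact: mm'.
  - exact: measurable_xsection.
  - by rewrite /xsection/= inE/= => /(BI _ (lift ord0 i)); rewrite /cons_pair tnthS.
apply: (@integral_restr _ _ I); first exact: mm'.
move=> x Ix; rewrite (_ : xsection _ x = set0).
  exact: (prod_measure0 (fun i => mu' (lift ord0 i))).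
by apply/seteqP; split=> t //; rewrite /xsection/= inE/= => /(BI _ ord0).
Qed.

End restriction.

Lemma sub_measure_vol (R : realType) (n : nat) (K : set 'rV[R]_n) (M : R)
    (mu : 'I_n -> {measure set (measurableTypeR R) -> \bar R})
    (mu' : 'I_n -> {finite_measure set (measurableTypeR R) -> \bar R})
    (S : {set 'I_n}) :
  0 <= M -> compact K -> (forall x i, K x -> `|x 0 i| <= M) ->
  (forall k U, measurable U -> U `<=` [set` `[- M, M]] -> mu' k U = mu k U) ->
  sub_measure mu S K = (fine (coord_measure mu' S (@row_of R n @^-1` K)))%:E.
Proof.
move=> M0 cK KM mm'; rewrite -coord_measure_finE; last exact: measurable_row_compact.
rewrite coord_measureE /sub_measure; apply: (@prod_measure_restr R [set` `[- M, M]]).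
- by move=> k; exact: mm'.
- have := @measurable_embed R n S measurableT _ (measurable_row_compact cK).
  rewrite setTI; congr measurable.
  by apply/seteqP; split=> t /=; rewrite row_of_embed.
- move=> t i /= /(KM _ (enum_val i)).
  by rewrite coord_embed_val in_itv/= ler_norml.
Qed.

(** * Complementary covers and the theorem *)

Lemma uniform_cover_full (n m lambda : nat) (sigma : {set 'I_n}) (s : 'I_m -> {set 'I_n}) :
  uniform_cover lambda sigma s -> m = lambda -> forall i, s i = sigma.
Proof.
move=> [ss cover] ml i; apply/eqP; rewrite finset.eqEsubset ss/=; apply/fintype.subsetP => j js.
have := cover j js; rewrite -ml (card_classical_set (fun i => j \in s i)) => h.
have := @subset_cardP _ (fun i => j \in s i) predT.
by rewrite cardT size_enum_ord h => /(_ erefl (subset_predT _)) /(_ i).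
Qed.

Lemma uniform_cover_compl (n m lambda : nat) (sigma : {set 'I_n}) (s : 'I_m -> {set 'I_n}) :
  uniform_cover lambda sigma s -> forall j, j \in sigma ->
  #|[set i | j \in (sigma :\: s i)%SET]| = (m - lambda)%N.
Proof.
move=> [_ cover] j js; rewrite -(cover j js) -[X in (X - _)%N](card_ord m).
rewrite -(cardC (fun i => j \in s i)) (card_classical_set (fun i => j \in s i)) addKn.
rewrite (card_classical_set (fun i => j \in (sigma :\: s i)%SET)).
by apply: eq_card => i; rewrite [LHS]inE /= inE js andbT.
Qed.

Theorem theorem24 (R : realType) (n : nat)
    (mu : 'I_n -> {measure set (measurableTypeR R) -> \bar R})
    (phi : 'I_n -> R -> R)
    (hphi : forall k, even_decreasing_density (phi k))
    (hmu : forall k, has_density (mu k) (phi k))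
    (sigma : {set 'I_n}) (m lambda : nat)
    (hlambda : (1 <= lambda)%N) (hm : (lambda <= m)%N)
    (s : 'I_m -> {set 'I_n}) (hs : uniform_cover lambda sigma s)
    (K : set 'rV[R]_n) (hK : convex_body K) (hKu : unconditional K) :
  (sub_measure mu [set: 'I_n]%SET K ^+ (m - lambda) *
     sub_measure mu (~: sigma) (ortho_proj (ortho_span sigma) K) ^+ lambda
   <= ((\prod_(i < m) ('C(n - #|s i|, n - #|sigma|))%:R)%R /
        ('C(n, n - #|sigma|))%:R ^+ (m - lambda))%R%:E *
      \prod_(i < m)
        sub_measure mu (~: s i) (ortho_proj (ortho_span (s i)) K))%E.
Proof.
have [[x0 Kx0] cK convK] := hK.
have [M M0 KM] := compact_row_bound cK.
pose I : set (measurableTypeR R) := [set` `[- M, M]].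
have mI : measurable I by exact: measurable_itv.
have Ifin k : (mu k I < +oo)%E.
  by rewrite -ge0_fin_numE//; exact: density_itv_fin (hphi k) (hmu k) M.
pose mu' k : {finite_measure set (measurableTypeR R) -> \bar R} := mfrestr mI (Ifin k).
have mu'E k U : measurable U -> U `<=` I -> mu' k U = mu k U.
  by move=> mU UI; rewrite /mu' /= /mfrestr /mrestr setIidl.
have conc k : concave_on_solid (mu' k).
  exact: (density_concave_on_solid (hphi k) (hmu k) M0).
set A := @row_of R n @^-1` K.
pose vol S : R := fine (coord_measure mu' S A).
have projE t : sub_measure mu (~: t)%SET (ortho_proj (ortho_span t) K) = (vol (~: t)%SET)%:E.
  by rewrite -(sub_measure_vol _ M0 cK KM mu'E) /sub_measure ortho_proj_section.
rewrite (sub_measure_vol _ M0 cK KM mu'E) projE.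
under [X in (_ <= _ * X)%E]eq_bigr do rewrite projE.
rewrite prodEFin -!EFin_expe -!EFinM lee_fin -/A -/(vol _).
set V := vol (~: sigma)%SET; set W := vol _.
have [ss cover] := hs.
have vol0 S : 0 <= vol S by exact: vol_ge0.
have trivial_case : (forall i, s i = sigma) -> (m = lambda \/ sigma = finset.set0) ->
  W ^+ (m - lambda) * V ^+ lambda <=
  \prod_(i < m) 'C(n - #|s i|, n - #|sigma|)%:R / 'C(n, n - #|sigma|)%:R ^+ (m - lambda) *
  \prod_(i < m) vol (~: s i)%SET.
  move=> se h.
  under [X in _ <= X / _ * _]eq_bigr do rewrite se binn.
  under [X in _ <= _ * X]eq_bigr do rewrite se.
  rewrite big1// prodr_const card_ord mul1r -/V.
  case: h => [->|s0]; first by rewrite subnn !expr0 invr1.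
  rewrite /V s0 cards0 subn0 binn expr1n invr1 mul1r finset.setC0 -exprD subnK//.
have [ml|ml] := eqVneq m lambda.
  by apply: trivial_case; [exact: uniform_cover_full hs ml|left].
have [s0|s0] := eqVneq sigma finset.set0.
  apply: trivial_case; [move=> i|by right].
  by have := ss i; rewrite s0 finset.subset0 => /eqP.
have k0 : (0 < m - lambda)%N by rewrite subn_gt0 ltn_neqAle eq_sym ml.
have A0 : A (zero_tuple R n).
  apply: (@solid_row _ _ K convK hKu _ [tuple x0 0 i | i < n]).
    rewrite /preimage /= (_ : row_of _ = x0)//.
    by apply/rowP => i; rewrite mxE tnth_mktuple.
  by move=> i; rewrite tnth_mktuple normr0.
have := @local_loomis_whitney R n mu' conc sigma A m (m - lambda)
  (fun i => (sigma :\: s i)%SET) (measurable_row_compact cK) (solid_row convK hKu)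
  (convex_tuples_row convK) A0 k0.
rewrite card_gt0 => /(_ s0 (fun i => finset.subsetDl _ _) (uniform_cover_compl hs)).
rewrite -/(vol _) -/V -/(vol _) -/W.
have dn : (#|sigma| <= n)%N by rewrite -[leqRHS]card_ord; exact: max_card.
(* The complement of [s i] is the disjoint union of those of [sigma] in the whole and of [s i] in
   [sigma], which identifies both the binomials and the volumes. *)
have -> : \prod_(i < m) ('C(n - #|sigma| + #|(sigma :\: s i)%SET|, n - #|sigma|)%:R *
    fine (coord_measure mu' (~: sigma :|: (sigma :\: s i))%SET A)) =
  \prod_(i < m) ('C(n - #|s i|, n - #|sigma|)%:R : R) * \prod_(i < m) vol (~: s i)%SET.
  rewrite -big_split/=; apply: eq_bigr => i _.
  have si : (#|s i| <= #|sigma|)%N by exact: subset_leq_card.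
  rewrite cardsDS// addnBA// subnK//; congr (_ * fine (coord_measure mu' _ A)).
  apply/setP => j; rewrite !inE; have := fintype.subsetP (ss i) j.
  by case: (j \in sigma); case: (j \in s i) => // /(_ isT).
(* A null base makes the left side 0 because [lambda] is positive; otherwise [V ^+ (m - lambda)]
   cancels. *)
have [V0|Vn0] := eqVneq V 0.
  move=> _; rewrite V0 expr0n eqn0Ngt hlambda mulr0.
  rewrite mulr_ge0//; last by apply: prodr_ge0.
  by rewrite divr_ge0// ?exprn_ge0// prodr_ge0.
have Vp : 0 < V ^+ (m - lambda) by rewrite exprn_gt0// lt_def Vn0 vol0.
rewrite -{1}(subnK hm) exprD expr_div_n -!mulrA ler_pM2l//.
rewrite mulrC [X in _ <= X -> _]mulrC -mulrA.
by rewrite [X in _ -> _ <= _ * X]mulrC.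
Qed.
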